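(* Let $\alpha$ be an infinite regular cardinal. (1) Assume $\alpha>\aleph_0$. Let $\mathcal C'$ be an $\alpha$-smashing triangulated category, $\mathcal P\subset \mathrm{Obj}\,\mathcal C'$ an $\alpha$-negative class of objects, and $\mathcal C=\langle \mathcal P\rangle^{\alpha}$ the $\alpha$-localizing subcategory of $\mathcal C'$ generated by $\mathcal P$. Then there exists an $\alpha$-smashing weight structure $w$ on $\mathcal C$ that is $\alpha$-generated by $\mathcal P$. (2) Conversely, if $\mathcal C$ is an $\alpha$-smashing triangulated category and a weight structure $w$ on $\mathcal C$ is $\alpha$-generated by some $\mathcal P\subset \mathrm{Obj}\,\mathcal C$, then $\mathcal P$ is $\alpha$-negative. Moreover, $w$ is left non-degenerate and is generated by $\mathcal P$. (3) For $(\mathcal C,w,\mathcal P)$ as in (2), the heart of $w$ consists of all $\mathcal C$-retracts of coproducts of families of elements of $\mathcal P$ of cardinality less than $\alpha$. (4) Let $(\mathcal C,w,\mathcal P)$ be as in (2), and let $F:\mathcal C\to\mathcal D$ be an exact functor respecting coproducts of less than $\alpha$ objects, where $\mathcal D$ is a triangulated category endowed with a weight structure $v$. Then $F$ is left weight-exact if and only if $F(\mathcal P)\subset \mathcal D_{v\le 0}$. Moreover, if $v$ (along with $\mathcal D$) is $\alpha$-smashing, then $F$ is right weight-exact if and only if $F(\mathcal P)\subset\mathcal D_{v\ge 0}$. (5) In the situation of the first sentence of (4), suppose in addition that $F$ is weight-exact and surjective on objects, and that $\alpha>\aleph_0$. Then the weight structure $v$ is $\alpha$-generated by $F(\mathcal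 P)$. In particular, $w$ is the only $\alpha$-smashing weight structure on $\mathcal C$ whose heart contains $\mathcal P$. (6) Assume that $\alpha\ge \aleph_1$ and $\mathcal C$ is an $\alpha$-smashing triangulated category. Then a class $\mathcal P\subset\mathrm{Obj}\,\mathcal C$ is $\alpha$-negative if and only if the class $\mathcal P^{\alpha}$ consisting of all coproducts of families of elements of $\mathcal P$ of cardinality less than $\alpha$ is countably negative.
   Context: All categories are locally small. For classes $X,Y$ of objects of a triangulated category $\mathcal C$, $X\perp Y$ means $\mathcal C(M,N)=0$ for all $M\in X$, $N\in Y$; $X^{\perp}=\{N: X\perp \{N\}\}$. An object $X$ is a retract of $Y$ if $\mathrm{id}_X$ factors through $Y$. $C$ is an extension of $B$ by $A$ if there is a distinguished triangle $A\to C\to B\to A[1]$; a class of objects is extension-closed if it contains $0$ and is closed under extensions (hence under isomorphisms). An additive category is $\alpha$-smashing if it has coproducts of all families of fewer than $\alpha$ objects; a class of its objects is $\alpha$-smashing if it is closed under such coproducts. In an $\alpha$-smashing triangulated category, $[\mathcal P]^{\alpha}$ denotes the smallest extension-closed $\alpha$-smashing class of objects containing $\mathcal P$. A full triangulated subcategory is $\alpha$-localizing if its class of objects is $\alpha$-smashing; $\langle\mathcal P\rangle^{\alpha}$, the $\alpha$-localizing subcategory generated by $\mathcal P$, is the full subcategory with object class $[\bigcup_{i\in\mathbb Z}\mathcal P[i]]^{\alpha}$. $\mathcal P$ is $\alpha$-negative if $\mathcal P\perp[\bigcup_{i>0}\mathcal P[i]]^{\alpha}$; countably negative means $\aleph_1$-negative.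 A weight structure $w$ on a triangulated category $\mathcal C$ is a pair of classes $\mathcal C_{w\le 0},\mathcal C_{w\ge 0}\subset\mathrm{Obj}\,\mathcal C$ such that: (i) both are closed under $\mathcal C$-retracts; (ii) $\mathcal C_{w\le 0}\subset\mathcal C_{w\le 0}[1]$ and $\mathcal C_{w\ge 0}[1]\subset \mathcal C_{w\ge 0}$; (iii) $\mathcal C_{w\le 0}\perp\mathcal C_{w\ge 0}[1]$; (iv) every $M\in\mathrm{Obj}\,\mathcal C$ fits into a distinguished triangle $LM\to M\to RM\to LM[1]$ with $LM\in\mathcal C_{w\le 0}$, $RM\in\mathcal C_{w\ge 0}[1]$. The heart is the full subcategory with object class $\mathcal C_{w=0}=\mathcal C_{w\le 0}\cap\mathcal C_{w\ge 0}$. $\mathcal C_{w\ge i}=\mathcal C_{w\ge 0}[i]$, $\mathcal C_{w\le i}=\mathcal C_{w\le 0}[i]$. $w$ is left non-degenerate if every object of $\bigcap_{l\in\mathbb Z}\mathcal C_{w\ge l}$ is zero. $w$ is $\alpha$-smashing if $\mathcal C$ and $\mathcal C_{w\ge 0}$ are $\alpha$-smashing. $w$ is $\alpha$-generated by $\mathcal P$ if $\mathcal C$ is $\alpha$-smashing, $\mathcal C_{w\ge 0}=[\bigcup_{i\ge 0}\mathcal P[i]]^{\alpha}$ and $\mathcal C_{w\le 0}=[\bigcup_{i\le 0}\mathcal P[i]]^{\alpha}$. $w$ is generated by $\mathcal P$ if $\mathcal C_{w\ge 0}=(\bigcup_{i<0}\mathcal P[i])^{\perp}$. For triangulated categories $(\mathcal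 C,w)$, $(\mathcal D,v)$ with weight structures, an exact functor $F:\mathcal C\to\mathcal D$ is left (resp. right) weight-exact if $F(\mathcal C_{w\le 0})\subset\mathcal D_{v\le 0}$ (resp. $F(\mathcal C_{w\ge 0})\subset\mathcal D_{v\ge 0}$), and weight-exact if it is both. *)

(* Defs.v *)
From HB Require Import structures.
From mathcomp Require Import all_boot all_order all_algebra.
From mathcomp Require Import boolp classical_sets functions cardinality.

Set Implicit Arguments.
Unset Strict Implicit.
Unset Printing Implicit Defensive.

Import GRing.Theory.
Local Open Scope classical_set_scope.
Local Open Scope card_scope.
Local Open Scope ring_scope.

(* A cardinal is represented by any type of that cardinality. *)

Definition card_lt (I A : Type) : Prop :=
  [set: I] #<= [set: A] /\ ~ ([set: A] #<= [set: I]).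

Definition infinite_regular (A : Type) : Prop :=
  [set: nat] #<= [set: A] /\
  forall (J : Type) (I : J -> Type),
    card_lt J A -> (forall j, card_lt (I j) A) -> card_lt {j : J & I j} A.

(* [B] has cardinality [aleph_1], the least uncountable cardinal. *)
Definition is_aleph1 (B : Type) : Prop :=
  card_lt nat B /\ forall I : Type, card_lt nat I -> [set: B] #<= [set: I].

(* Preadditive categories; classes of objects are sets [set C]. No size condition relates objects and morphisms;
   the morphisms between two objects form a type, so that all categories here
   are locally small. *)
Record category := Category {
  obj :> Type;
  hom : obj -> obj -> zmodType;
  idm : forall X, hom X X;
  comp : forall X Y Z, hom Y Z -> hom X Y -> hom X Z;
  comp1m : forall X Y (f : hom X Y), comp (idm Y) f = f;
  compm1 : forall X Y (f : hom X Y), comp f (idm X) = f;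
  compA : forall X Y Z T (h : hom Z T) (g : hom Y Z) (f : hom X Y),
    comp h (comp g f) = comp (comp h g) f;
  compDl : forall X Y Z (g g' : hom Y Z) (f : hom X Y),
    comp (g + g') f = comp g f + comp g' f;
  compDr : forall X Y Z (g : hom Y Z) (f f' : hom X Y),
    comp g (f + f') = comp g f + comp g f'
}.
Arguments hom {c}.
Arguments idm {c}.
Arguments comp {c X Y Z}.

Notation "g \oc f" := (comp g f) (at level 40, left associativity).

Definition is_zero (C : category) (X : C) : Prop := idm X = 0.

Definition is_iso (C : category) (X Y : C) (f : hom X Y) : Prop :=
  exists g : hom Y X, g \oc f = idm X /\ f \oc g = idm Y.

Definition iso (C : category) (X Y : C) : Prop :=
  exists f : hom X Y, is_iso f.

Definition retract (C : category) (X Y : C) : Prop :=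
  exists (i : hom X Y) (p : hom Y X), p \oc i = idm X.

Definition is_coproduct (C : category) (I : Type) (X : I -> C) (S : C)
    (inj : forall i, hom (X i) S) : Prop :=
  forall (T : C) (f : forall i, hom (X i) T),
    exists! g : hom S T, forall i, g \oc inj i = f i.

Definition is_biproduct (C : category) (X Y S : C) : Prop :=
  exists (i1 : hom X S) (i2 : hom Y S) (p1 : hom S X) (p2 : hom S Y),
    [/\ p1 \oc i1 = idm X, p2 \oc i2 = idm Y, p2 \oc i1 = 0, p1 \oc i2 = 0
      & i1 \oc p1 + i2 \oc p2 = idm S].

Record additive_functor (C D : category) := AdditiveFunctor {
  fobj :> C -> D;
  fmap : forall X Y, hom X Y -> hom (fobj X) (fobj Y);
  fmap1 : forall X, fmap (idm X) = idm (fobj X);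
  fmapM : forall X Y Z (g : hom Y Z) (f : hom X Y),
    fmap (g \oc f) = fmap g \oc fmap f;
  fmapD : forall X Y (f g : hom X Y), fmap (f + g) = fmap f + fmap g
}.
Arguments fmap {C D} a {X Y}.

(* The shift is an autoequivalence, not necessarily a strict automorphism: it
   is fully faithful, and [unsh X] is a chosen preimage of [X] up to
   isomorphism. The axioms on [dist] are Verdier's: [dist_iso], [dist_id] and
   [dist_cone] form (TR1), and the last three are (TR2)-(TR4). *)
Record tricat := TriCat {
  tcat :> category;
  has_zero : exists Z : tcat, is_zero Z;
  has_biproduct : forall X Y : tcat, exists S, is_biproduct X Y S;
  sh : additive_functor tcat tcat;
  sh_ff : forall X Y : tcat, bijective (@fmap _ _ sh X Y);
  unsh : tcat -> tcat;
  sh_unsh : forall X, iso (sh (unsh X)) X;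
  dist : forall A B C : tcat, hom A B -> hom B C -> hom C (sh A) -> Prop;
  dist_iso : forall (A B C A' B' C' : tcat)
      (u : hom A B) (v : hom B C) (w : hom C (sh A))
      (u' : hom A' B') (v' : hom B' C') (w' : hom C' (sh A'))
      (a : hom A A') (b : hom B B') (c : hom C C'),
    is_iso a -> is_iso b -> is_iso c ->
    b \oc u = u' \oc a -> c \oc v = v' \oc b ->
    fmap sh a \oc w = w' \oc c ->
    dist u v w -> dist u' v' w';
  dist_id : forall X Z : tcat, is_zero Z ->
    dist (idm X) (0 : hom X Z) (0 : hom Z (sh X));
  dist_cone : forall (A B : tcat) (u : hom A B),
    exists C (v : hom B C) (w : hom C (sh A)), dist u v w;
  dist_rot : forall (A B C : tcat)
      (u : hom A B) (v : hom B C) (w : hom C (sh A)),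
    dist u v w <-> dist v w (- fmap sh u);
  dist_mor : forall (A B C A' B' C' : tcat)
      (u : hom A B) (v : hom B C) (w : hom C (sh A))
      (u' : hom A' B') (v' : hom B' C') (w' : hom C' (sh A'))
      (a : hom A A') (b : hom B B'),
    dist u v w -> dist u' v' w' -> b \oc u = u' \oc a ->
    exists c : hom C C', c \oc v = v' \oc b /\ fmap sh a \oc w = w' \oc c;
  dist_oct : forall (X Y Z Z' X' Y' : tcat) (u : hom X Y) (v : hom Y Z)
      (i : hom Y Z') (i' : hom Z' (sh X))
      (j : hom Z X') (j' : hom X' (sh Y))
      (k : hom Z Y') (k' : hom Y' (sh X)),
    dist u i i' -> dist v j j' -> dist (v \oc u) k k' ->
    exists (f : hom Z' Y') (g : hom Y' X'),
      [/\ dist f g (fmap sh i \oc j'), f \oc i = k \oc v, k' \oc f = i',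
          g \oc k = j & j' \oc g = fmap sh u \oc k']
}.
Arguments sh {t}.
Arguments unsh {t}.
Arguments dist {t A B C}.

Section TriangulatedNotions.
Variable C : tricat.
Implicit Types (P Q D : set C) (A : Type).

Definition shiftz (i : int) (M : C) : C :=
  match i with
  | Posz n => iter n sh M
  | Negz n => iter n.+1 unsh M
  end.

(* The class [P[i]]; as the shift is only an equivalence, it is taken up to
   isomorphism. *)
Definition shift_class (i : int) P : set C :=
  [set N | exists2 M, P M & iso N (shiftz i M)].

Definition orth P Q : Prop :=
  forall M N, P M -> Q N -> forall f : hom M N, f = 0.

Definition right_orth P : set C := [set N | orth P [set N]].

Definition retract_closed D : Prop :=
  forall X Y, retract X Y -> D Y -> D X.

(* Closure under isomorphism follows: see [extension_iso] below. *)
Definition extension_closed D : Prop :=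
  (forall Z, is_zero Z -> D Z) /\
  forall (X Y Z : C) (u : hom X Y) (v : hom Y Z) (w : hom Z (sh X)),
    dist u v w -> D X -> D Z -> D Y.

Definition class_smashing A D : Prop :=
  forall (I : Type) (X : I -> C) (S : C) (inj : forall i, hom (X i) S),
    card_lt I A -> is_coproduct inj -> (forall i, D (X i)) -> D S.

Definition smashing A : Prop :=
  forall (I : Type) (X : I -> C), card_lt I A ->
    exists (S : C) (inj : forall i, hom (X i) S), is_coproduct inj.

(* The class [[P]^A], for [A] a type of cardinality alpha. *)
Definition gen A P : set C :=
  [set M | forall D, extension_closed D -> class_smashing A D ->
             P `<=` D -> D M].

(* The object class of the localizing subcategory generated by [P]; it is the
   object class of a full triangulated subcategory by [loc_tri_closed]. *)
Definition loc A P : set C := gen A (\bigcup_i shift_class i P).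

Definition negative A P : Prop :=
  orth P (gen A (\bigcup_(i in [set i : int | 0 < i]) shift_class i P)).

Definition small_coproducts A P : set C :=
  [set S | exists (I : Type) (X : I -> C) (inj : forall i, hom (X i) S),
     [/\ card_lt I A, forall i, P (X i) & is_coproduct inj]].

Record weight_structure := WeightStructure {
  wle : set C;
  wge : set C;
  wle_retract : retract_closed wle;
  wge_retract : retract_closed wge;
  wle_shift : wle `<=` shift_class 1 wle;
  wge_shift : shift_class 1 wge `<=` wge;
  w_orth : orth wle (shift_class 1 wge);
  w_decomp : forall M : C, exists (L R : C)
      (u : hom L M) (v : hom M R) (d : hom R (sh L)),
    [/\ dist u v d, wle L & shift_class 1 wge R]
}.
Implicit Type w : weight_structure.

Definition heart w : set C := wle w `&` wge w.

Definition left_nondegenerate w : Prop :=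
  forall M, (forall l : int, shift_class l (wge w) M) -> is_zero M.

Definition w_smashing A w : Prop :=
  smashing A /\ class_smashing A (wge w).

Definition w_smashing_generated A P w : Prop :=
  [/\ smashing A,
      wge w = gen A (\bigcup_(i in [set i : int | 0 <= i]) shift_class i P)
    & wle w = gen A (\bigcup_(i in [set i : int | i <= 0]) shift_class i P)].

Definition w_generated P w : Prop :=
  wge w =
    right_orth (\bigcup_(i in [set i : int | i < 0]) shift_class i P).

(* Triangulated classes, i.e. object classes of strictly full triangulated
   subcategories. *)
Definition tri_closed D : Prop :=
  [/\ extension_closed D, forall M, D M -> D (sh M)
    & forall M, D M -> D (unsh M)].

End TriangulatedNotions.

Record exact_functor (C D : tricat) := ExactFunctor {
  efun :> additive_functor C D;
  esh : forall X : C, hom (efun (sh X)) (sh (efun X));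
  esh_iso : forall X, is_iso (esh X);
  esh_nat : forall (X Y : C) (f : hom X Y),
    esh Y \oc fmap efun (fmap sh f) = fmap sh (fmap efun f) \oc esh X;
  efun_dist : forall (X Y Z : C) (u : hom X Y) (v : hom Y Z)
      (w : hom Z (sh X)),
    dist u v w -> dist (fmap efun u) (fmap efun v) (esh X \oc fmap efun w)
}.

Definition respects_coproducts (A : Type) (C D : tricat)
    (F : exact_functor C D) : Prop :=
  forall (I : Type) (X : I -> C) (S : C) (inj : forall i, hom (X i) S),
    card_lt I A -> is_coproduct inj ->
    is_coproduct (fun i => fmap F (inj i)).

Definition left_weight_exact (C D : tricat) (w : weight_structure C)
    (v : weight_structure D) (F : exact_functor C D) : Prop :=
  F @` wle w `<=` wle v.

Definition right_weight_exact (C D : tricat) (w : weight_structure C)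
    (v : weight_structure D) (F : exact_functor C D) : Prop :=
  F @` wge w `<=` wge v.

Definition weight_exact (C D : tricat) (w : weight_structure C)
    (v : weight_structure D) (F : exact_functor C D) : Prop :=
  left_weight_exact w v F /\ right_weight_exact w v F.

Lemma dep_choice (I : Type) (T : I -> Type) (R : forall i, T i -> Prop) :
  (forall i, exists t, R i t) -> exists f : forall i, T i, forall i, R i (f i).
Proof.
by move=> H; exists (fun i => sval (cid (H i))) => i; exact: svalP (cid (H i)).
Qed.

Section CategoryLemmas.
Variable C : category.
Implicit Types X Y Z T : C.

Lemma comp0m X Y Z (f : hom X Y) : (0 : hom Y Z) \oc f = 0.
Proof. by apply: (@addrI _ (0 \oc f)); rewrite -compDl !addr0. Qed.

Lemma compm0 X Y Z (g : hom Y Z) : g \oc (0 : hom X Y) = 0.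
Proof. by apply: (@addrI _ (g \oc 0)); rewrite -compDr !addr0. Qed.

Lemma compNm X Y Z (g : hom Y Z) (f : hom X Y) : (- g) \oc f = - (g \oc f).
Proof. by apply: (@addrI _ (g \oc f)); rewrite -compDl !subrr comp0m. Qed.

Lemma compmN X Y Z (g : hom Y Z) (f : hom X Y) : g \oc (- f) = - (g \oc f).
Proof. by apply: (@addrI _ (g \oc f)); rewrite -compDr !subrr compm0. Qed.

Lemma is_iso_idm X : is_iso (idm X).
Proof. by exists (idm X); rewrite comp1m. Qed.

Lemma is_iso_comp X Y Z (g : hom Y Z) (f : hom X Y) :
  is_iso g -> is_iso f -> is_iso (g \oc f).
Proof.
move=> [g' [g'g gg']] [f' [f'f ff']]; exists (f' \oc g'); split.
- by rewrite compA -(compA f') g'g compm1.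
- by rewrite compA -(compA g) ff' compm1.
Qed.

Lemma iso_refl X : iso X X.
Proof. by exists (idm X); exact: is_iso_idm. Qed.

Lemma iso_sym X Y : iso X Y -> iso Y X.
Proof. by move=> [f [g [gf fg]]]; exists g, f. Qed.

Lemma iso_trans X Y Z : iso X Y -> iso Y Z -> iso X Z.
Proof.
by move=> [f isf] [g isg]; exists (g \oc f); exact: is_iso_comp.
Qed.

Lemma zero_eq0 Z X (f : hom X Z) : is_zero Z -> f = 0.
Proof. by move=> Z0; rewrite -(comp1m f) Z0 comp0m. Qed.

Lemma zero_eq0l Z X (f : hom Z X) : is_zero Z -> f = 0.
Proof. by move=> Z0; rewrite -(compm1 f) Z0 compm0. Qed.

Lemma iso_zero X Y : iso X Y -> is_zero X -> is_zero Y.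
Proof.
move=> [f [g [_ fg]]] X0; rewrite /is_zero -fg.
by rewrite (zero_eq0l f X0) comp0m.
Qed.

(* Coproducts are stable under isomorphism of the summands and of the sum. *)
Lemma coproduct_iso (I : Type) (X X' : I -> C) (S S' : C)
    (inj : forall i, hom (X i) S) (inj' : forall i, hom (X' i) S')
    (a : forall i, hom (X i) (X' i)) (s : hom S S') :
  (forall i, is_iso (a i)) -> is_iso s ->
  (forall i, s \oc inj i = inj' i \oc a i) ->
  is_coproduct inj -> is_coproduct inj'.
Proof.
move=> isa [s' [s's ss']] comm cop T f.
have [g [gP gU]] := cop T (fun i => f i \oc a i).
exists (g \oc s'); split => [i|h hP].
- have [b [ba ab]] := isa i.
  have -> : inj' i = s \oc inj i \oc b by rewrite comm -compA ab compm1.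
  by rewrite -!compA (compA s') s's comp1m compA gP -compA ab compm1.
- rewrite (gU (h \oc s)); first by rewrite -compA ss' compm1.
  by move=> i; rewrite -compA comm compA hP.
Qed.

End CategoryLemmas.

Section FunctorLemmas.
Variables (C D : category) (F : additive_functor C D).

Lemma fmap0 X Y : fmap F (0 : hom X Y) = 0.
Proof. by apply: (@addrI _ (fmap F 0)); rewrite -fmapD !addr0. Qed.

Lemma fmapN X Y (f : hom X Y) : fmap F (- f) = - fmap F f.
Proof. by apply: (@addrI _ (fmap F f)); rewrite -fmapD !subrr fmap0. Qed.

Lemma fmap_iso X Y (f : hom X Y) : is_iso f -> is_iso (fmap F f).
Proof. by move=> [g [gf fg]]; exists (fmap F g); rewrite -!fmapM gf fg !fmap1. Qed.

Lemma fobj_iso X Y : iso X Y -> iso (F X) (F Y).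
Proof. by move=> [f isf]; exists (fmap F f); exact: fmap_iso. Qed.

Lemma fobj_zero X : is_zero X -> is_zero (F X).
Proof. by rewrite /is_zero -fmap1 => ->; rewrite fmap0. Qed.

End FunctorLemmas.

Section TriangulatedLemmas.
Variable C : tricat.
Implicit Types (X Y Z : C) (P D : set C).

Lemma sh_inj X Y : injective (fmap sh : hom X Y -> hom (sh X) (sh Y)).
Proof. exact: bij_inj (sh_ff X Y). Qed.

Lemma sh_surj X Y (g : hom (sh X) (sh Y)) : exists f : hom X Y, fmap sh f = g.
Proof. by have [h _ hK] := sh_ff X Y; exists (h g); rewrite hK. Qed.

Lemma sh_iso X Y : iso (sh X) (sh Y) -> iso X Y.
Proof.
move=> [f [g [gf fg]]]; have [f' f'E] := sh_surj f.
have [g' g'E] := sh_surj g; exists f', g'; split; apply: sh_inj.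
- by rewrite fmapM f'E g'E gf fmap1.
- by rewrite fmapM f'E g'E fg fmap1.
Qed.

Lemma unsh_sh X : iso (unsh (sh X)) X.
Proof. exact: sh_iso (sh_unsh _). Qed.

Lemma unsh_iso X Y : iso X Y -> iso (unsh X) (unsh Y).
Proof.
move=> XY; apply: sh_iso; apply: iso_trans (sh_unsh X) _.
by apply: iso_trans XY _; apply: iso_sym; exact: sh_unsh.
Qed.

Lemma sh_zero X : is_zero (sh X) -> is_zero X.
Proof. by move=> X0; apply: sh_inj; rewrite fmap1 fmap0. Qed.

Lemma unsh_zero X : is_zero X -> is_zero (unsh X).
Proof.
by move=> X0; apply: sh_zero; apply: iso_zero X0; apply/iso_sym/sh_unsh.
Qed.

Lemma dist_comp0 (X Y Z : C) (u : hom X Y) (v : hom Y Z) (w : hom Z (sh X)) :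
  dist u v w -> v \oc u = 0.
Proof.
move=> uvw; have [O O0] := has_zero C.
have [|c [cE _]] := dist_mor (a := idm X) (b := u) (dist_id X O0) uvw.
  by rewrite compm1.
by rewrite -cE compm0.
Qed.

Lemma dist_factor (X Y Z T : C) (u : hom X Y) (v : hom Y Z) (w : hom Z (sh X))
    (f : hom Y T) :
  dist u v w -> f \oc u = 0 -> exists g : hom Z T, f = g \oc v.
Proof.
move=> uvw fu0; have [O O0] := has_zero C.
have d1 : dist (0 : hom O T) (idm T) (0 : hom T (sh O)).
  apply/dist_rot; rewrite fmap0 oppr0.
  exact: (dist_id T (fobj_zero sh O0)).
have [|g [gE _]] := dist_mor (a := (0 : hom X O)) (b := f) uvw d1.
  by rewrite compm0.
by exists g; rewrite gE comp1m.
Qed.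

Lemma extension_iso D X Y : extension_closed D -> iso X Y -> D X -> D Y.
Proof.
move=> [D0 Dext] [f [g [gf fg]]] DX; have [O O0] := has_zero C.
have d : dist f (0 : hom Y O) (0 : hom O (sh X)).
  apply: (dist_iso (a := idm X) (b := f) (c := idm O)) (dist_id X O0).
  - exact: is_iso_idm.
  - by exists g.
  - exact: is_iso_idm.
  - by [].
  - by rewrite compm0 comp0m.
  - by rewrite compm0 comp0m.
by apply: Dext d DX _; exact: D0.
Qed.

Lemma biproduct_dist X Y S : is_biproduct X Y S ->
  exists (Z : C) (u : hom X S) (v : hom S Z) (w : hom Z (sh X)),
    dist u v w /\ iso Y Z.
Proof.
move=> [i1 [i2 [p1 [p2 [p1i1 p2i2 p2i1 p1i2 sumE]]]]].
have [Z [v [w d]]] := dist_cone i1.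
exists Z, i1, v, w; split=> //.
have w0 : w = 0.
  have iw0 : fmap sh i1 \oc w = 0.
    apply: oppr_inj; rewrite oppr0 -compNm.
    exact: dist_comp0 ((dist_rot _ _ _).1 ((dist_rot _ _ _).1 d)).
  by rewrite -(comp1m w) -fmap1 -p1i1 fmapM -compA iw0 compm0.
have [c p2E] := dist_factor d p2i1.
exists (v \oc i2), c; split; first by rewrite compA -p2E.
apply/eqP; rewrite -subr_eq0; apply/eqP.
have vi1 := dist_comp0 d.
have h0 : (v \oc i2 \oc c - idm Z) \oc v = 0.
  rewrite compDl compNm comp1m -compA -p2E -compA.
  have -> : i2 \oc p2 = idm S - i1 \oc p1.
    by rewrite -sumE addrC addrA addNr add0r.
  by rewrite compDr compm1 compmN compA vi1 comp0m oppr0 addr0 subrr.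
have [e ->] := dist_factor ((dist_rot _ _ _).1 d) h0.
by rewrite w0 compm0.
Qed.

Lemma dist_sh X Y Z (u : hom X Y) (v : hom Y Z) (w : hom Z (sh X)) :
  dist u v w <-> dist (- fmap sh u) (- fmap sh v) (- fmap sh w).
Proof. by split=> [/dist_rot/dist_rot/dist_rot|d] //; do 3 apply/dist_rot. Qed.

Lemma coproduct_sh (I : Type) (X : I -> C) (S : C)
    (inj : forall i, hom (X i) S) :
  is_coproduct inj <-> is_coproduct (fun i => fmap sh (inj i)).
Proof.
split=> cop T f.
- have [e [e' [e'e ee']]] := sh_unsh T.
  have /dep_choice[f' f'E] : forall i, exists f' : hom (X i) (unsh T),
    fmap sh f' = e' \oc f i by move=> i; exact: sh_surj.
  have [g [gP gU]] := cop _ f'.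
  exists (e \oc fmap sh g); split=> [i|h hP].
    by rewrite -compA -fmapM gP f'E compA ee' comp1m.
  have [h' h'E] := sh_surj (e' \oc h).
  rewrite (gU h') ?h'E ?compA ?ee' ?comp1m// => i.
  by apply: sh_inj; rewrite fmapM h'E f'E -hP compA.
- have [g [gP gU]] := cop _ (fun i => fmap sh (f i)).
  have [g' g'E] := sh_surj g; exists g'; split=> [i|h hP].
    by apply: sh_inj; rewrite fmapM g'E gP.
  by apply: sh_inj; rewrite g'E; apply: gU => i; rewrite -fmapM hP.
Qed.

Lemma gen_sub (A : Type) P : P `<=` gen A P.
Proof. by move=> M PM D _ _; apply. Qed.

Lemma gen_extension (A : Type) P : extension_closed (gen A P).
Proof.
split=> [Z Z0 D [D0 _] _ _|X Y Z u v w d gX gZ D eD sD PD]; first exact: D0.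
by apply: (eD.2 _ _ _ _ _ _ d); [apply: gX|apply: gZ].
Qed.

Lemma gen_smashing (A : Type) P : class_smashing A (gen A P).
Proof.
move=> I X S inj IA cop gX D eD sD PD.
by apply: (sD _ _ _ _ IA cop) => i; exact: gX.
Qed.

Lemma gen_sh (A : Type) P :
  (forall M, P M -> gen A P (sh M)) -> forall M, gen A P M -> gen A P (sh M).
Proof.
move=> Psh M gM; apply: (gM [set N | gen A P (sh N)]) => //.
- split=> [Z Z0|X Y Z u v w d gX gZ].
    by apply: (gen_extension A P).1; exact: fobj_zero.
  exact: (gen_extension A P).2 ((dist_sh _ _ _).1 d) gX gZ.
- move=> I X S inj IA cop gX.
  exact: gen_smashing IA ((coproduct_sh _).1 cop) gX.
Qed.

Lemma gen_unsh (A : Type) P :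
  (forall M, P M -> gen A P (unsh M)) ->
  forall M, gen A P M -> gen A P (unsh M).
Proof.
move=> Psh M gM; apply: (gM [set N | gen A P (unsh N)]) => //.
- split=> [Z Z0|X Y Z u v w d gX gZ].
    by apply: (gen_extension A P).1; exact: unsh_zero.
  have [a [a' [a'a aa']]] := sh_unsh X.
  have [b [b' [b'b bb']]] := sh_unsh Y.
  have [c [c' [c'c cc']]] := sh_unsh Z.
  have [u' u'E] := sh_surj (- (b' \oc u \oc a)).
  have [v' v'E] := sh_surj (- (c' \oc v \oc b)).
  have [w' w'E] := sh_surj (- (fmap sh a' \oc w \oc c)).
  have d' : dist u' v' w'.
    apply/dist_sh; rewrite u'E v'E w'E !opprK.
    apply: (dist_iso (a := a') (b := b') (c := c')) d.
    - by exists a.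
    - by exists b.
    - by exists c.
    - by rewrite -!compA aa' compm1.
    - by rewrite -!compA bb' compm1.
    - by rewrite -!compA cc' compm1.
  exact: (gen_extension A P).2 d' gX gZ.
- move=> I X S inj IA cop gX.
  have /dep_choice[a aP] : forall i, exists a : hom (X i) (sh (unsh (X i))),
    is_iso a by move=> i; exact: iso_sym (sh_unsh _).
  have [s sP] := iso_sym (sh_unsh S).
  have /dep_choice[inj' injE] : forall i, exists j : hom (unsh (X i)) (unsh S),
      s \oc inj i = fmap sh j \oc a i.
    move=> i; have [a' [a'a aa']] := aP i.
    have [j jE] := sh_surj (s \oc inj i \oc a').
    by exists j; rewrite jE -compA a'a compm1.
  have cop' : is_coproduct inj'.
    by apply/coproduct_sh; exact: coproduct_iso aP sP injE cop.
  exact: (gen_smashing IA cop' gX).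
Qed.

Lemma sh_shiftz (i : int) (M : C) : iso (sh (shiftz i M)) (shiftz (i + 1) M).
Proof.
case: i => [n|[|n]].
- by rewrite -PoszD addn1; exact: iso_refl.
- exact: sh_unsh.
- have -> : Negz n.+1 + 1 = Negz n.
    by rewrite !NegzE -[n.+2]addn1 PoszD opprD addrNK.
  exact: sh_unsh.
Qed.

Lemma unsh_shiftz (i : int) (M : C) :
  iso (unsh (shiftz i M)) (shiftz (i - 1) M).
Proof.
apply: sh_iso; apply: iso_trans (sh_unsh _) _; apply: iso_sym.
by have := sh_shiftz (i - 1) M; rewrite subrK.
Qed.

Lemma loc_tri_closed (A : Type) P : tri_closed (loc A P).
Proof.
split; first exact: gen_extension.
- apply: gen_sh => M [i _ [N PN NM]]; apply: gen_sub; exists (i + 1) => //.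
  by exists N => //; exact: iso_trans (fobj_iso sh NM) (sh_shiftz _ _).
- apply: gen_unsh => M [i _ [N PN NM]]; apply: gen_sub; exists (i - 1) => //.
  by exists N => //; exact: iso_trans (unsh_iso NM) (unsh_shiftz _ _).
Qed.

End TriangulatedLemmas.

Section FullSubcategory.
Variables (C : tricat) (D : set C) (hD : tri_closed D).

Definition full_subcat : category :=
  @Category {M : C | D M} (fun M N => hom (sval M) (sval N))
    (fun M => idm (sval M)) (fun _ _ _ g f => g \oc f)
    (fun _ _ f => comp1m f) (fun _ _ f => compm1 f)
    (fun _ _ _ _ h g f => compA h g f)
    (fun _ _ _ g g' f => compDl g g' f) (fun _ _ _ g f f' => compDr g f f').

Let shD : forall M, D M -> D (sh M). Proof. by case: hD. Qed.
Let unshD : forall M, D M -> D (unsh M). Proof. by case: hD. Qed.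
Let extD : extension_closed D. Proof. by case: hD. Qed.

Definition sub_sh : additive_functor full_subcat full_subcat :=
  @AdditiveFunctor full_subcat full_subcat
    (fun M => exist D (sh (sval M)) (shD (svalP M)))
    (fun _ _ f => fmap sh f)
    (fun M => fmap1 sh (sval M)) (fun _ _ _ g f => fmapM sh g f)
    (fun _ _ f g => fmapD sh f g).

Definition sub_unsh (M : full_subcat) : full_subcat :=
  exist D (unsh (sval M)) (unshD (svalP M)).

Definition sub_dist (X Y Z : full_subcat) (u : hom X Y) (v : hom Y Z)
    (w : hom Z (sub_sh X)) : Prop :=
  @dist C (sval X) (sval Y) (sval Z) u v w.

Let sub_has_zero : exists Z : full_subcat, is_zero Z.
Proof. by have [Z Z0] := has_zero C; exists (exist D Z (extD.1 Z Z0)). Qed.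

Let sub_has_biproduct (X Y : full_subcat) : exists S, is_biproduct X Y S.
Proof.
have [S bS] := has_biproduct (sval X) (sval Y).
have [Z [u [v [w [d YZ]]]]] := biproduct_dist bS.
have DS : D S.
  exact: (extD.2 _ _ _ _ _ _ d (svalP X) (extension_iso extD YZ (svalP Y))).
by exists (exist D S DS).
Qed.

Let sub_dist_cone (A B : full_subcat) (u : hom A B) :
  exists X (v : hom B X) (w : hom X (sub_sh A)), sub_dist u v w.
Proof.
have [X [v [w d]]] := @dist_cone C (sval A) (sval B) u.
have DX : D X.
  apply: (extD.2 _ _ _ _ _ _ ((dist_rot _ _ _).1 d)); first exact: svalP.
  exact: shD (svalP A).
by exists (exist D X DX), v, w.
Qed.

Definition full_tri_subcat : tricat :=
  @TriCat full_subcat sub_has_zero sub_has_biproduct sub_sh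
    (fun X Y => sh_ff (sval X) (sval Y))
    sub_unsh (fun X => sh_unsh (sval X)) sub_dist
    (fun _ _ _ _ _ _ u v w u' v' w' a b c => @dist_iso C _ _ _ _ _ _
       u v w u' v' w' a b c)
    (fun X Z => @dist_id C (sval X) (sval Z))
    sub_dist_cone
    (fun _ _ _ u v w => @dist_rot C _ _ _ u v w)
    (fun _ _ _ _ _ _ u v w u' v' w' a b => @dist_mor C _ _ _ _ _ _
       u v w u' v' w' a b)
    (fun _ _ _ _ _ _ u v i i' j j' k k' => @dist_oct C _ _ _ _ _ _
       u v i i' j j' k k').

End FullSubcategory.

Definition loc_subcat (C : tricat) (A : Type) (P : set C) : tricat :=
  full_tri_subcat (loc_tri_closed A P).

(* [P] viewed as a class of objects of [loc_subcat A P]; every object of [P]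
   lies in [loc A P]. *)
Definition loc_class (C : tricat) (A : Type) (P : set C) :
    set (loc_subcat A P) :=
  [set M | P (sval M)].
Arguments loc_class {C} A P.

(* Main.v *)
From HB Require Import structures.
From mathcomp Require Import all_boot all_order all_algebra.
From mathcomp Require Import boolp classical_sets functions cardinality.
From mathcomp Require Import zify.
Require Import Defs.

Set Implicit Arguments.
Unset Strict Implicit.
Unset Printing Implicit Defensive.

Import Order.TTheory GRing.Theory Num.Theory.

Local Open Scope classical_set_scope.
Local Open Scope card_scope.

(** Everything rests on two closure arguments over generated classes.

    First, let [L] and [R] be extension-closed classes, closed under small
    coproducts, with [L] orthogonal to [R[1]]. The objects [M] that admit a
    triangle [X -> M -> Y] with [X] in [L] and [Y] in [R] are again closed
    under extensions and small coproducts ([ext_smashing_decomposable]), so a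
    generated class consists of such objects as soon as its generators do.
    When [P] is negative, the classes generated by its nonpositive and by its
    positive shifts are orthogonal, and every shift of [P] lies in one of
    them: this gives the weight decompositions in the localizing subcategory.
    Closure of both classes under retracts is the Eilenberg swindle
    ([swindle]), which needs countable coproducts. With [L] the class of small
    coproducts of objects of [P], which is extension-closed because its
    self-extensions split, the same closure gives each object of nonnegative
    weights a bottom cell in [L] ([bottom_cell]); the bottom cell of an object
    of the heart has that object as a retract.

    Second, each half of a weight structure is the orthogonal of the other, up
    to a shift, so the half [wle] contains a generated class once it contains
    its generators, and so does [wge] when it is closed under coproducts. This
    gives the criteria for weight-exactness and the uniqueness of the weight
    structure. For a functor surjective on objects, decomposing a preimage of
    an object of one half shows that object to be a retract of the image of
    one of the same half, and the swindle concludes again.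

    It remains to see that countable negativity of the class [Q] of small
    coproducts of [P] implies negativity of [P]. The positive class [G]
    generated by [Q] under countable coproducts turns out to be closed under
    all small ones ([gen_positive_smashing]). Indeed, splitting off bottom
    cells resolves an object of [G] by a tower [N = T 0 -> T 1 -> ...] of ever
    higher weights. Such a tower has vanishing homotopy colimit
    ([null_tower_weights]), a condition inherited by coproducts of towers, as
    is the fact that the cells come from [Q]; and it presents [T 0] by
    finite extensions of cells and countable coproducts
    ([null_tower_bottom]). *)

(** * Small cardinalities *)

Lemma card_lt_le (I A B : Type) :
  card_lt I A -> [set: A] #<= [set: B] -> card_lt I B.
Proof.
move=> [IA AI] AB; split; first exact: card_le_trans IA AB.
by move=> BI; apply: AI; exact: card_le_trans AB BI.
Qed.

Lemma card_lt_finite (T : finType) (A : Type) :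
  [set: nat] #<= [set: A] -> card_lt T A.
Proof.
move=> natA; split.
  exact: card_le_trans (countableP [set: T]) natA.
move=> AT; apply: infinite_nat.
have natT : [set: nat] #<= [set: T] by exact: card_le_trans natA AT.
exact: card_le_finite natT finite_finset.
Qed.

Section Triangles.
Local Open Scope ring_scope.
Variable C : tricat.
Implicit Types X Y Z T : C.

(** * Exactness and octahedra *)

Definition hom0 X Y : Prop := forall f : hom X Y, f = 0.

Lemma dist_lift X Y Z T (u : hom X Y) (v : hom Y Z) (w : hom Z (sh X))
    (f : hom T Y) :
  dist u v w -> v \oc f = 0 -> exists g : hom T X, f = u \oc g.
Proof.
move=> /dist_rot d vf0; have [O O0] := has_zero C.
have [|c [_ cE]] :=
    dist_mor (a := f) (b := 0 : hom O Z) ((dist_rot _ _ _).1 (dist_id T O0)) d.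
  by rewrite vf0 comp0m.
have [g gE] := sh_surj c; exists g; apply/sh_inj/oppr_inj.
by rewrite fmapM gE -compNm -cE compmN fmap1 compm1.
Qed.

Lemma dist_extend_sh X Y Z T (u : hom X Y) (v : hom Y Z) (w : hom Z (sh X))
    (f : hom (sh X) T) :
  dist u v w -> f \oc w = 0 -> exists g : hom (sh Y) T, f = g \oc fmap sh u.
Proof.
move=> /dist_rot/dist_rot d fw0; have [g ->] := dist_factor d fw0.
by exists (- g); rewrite compmN compNm.
Qed.

Lemma dist_transport X Y Z X' Y' Z' (u : hom X Y) (v : hom Y Z)
    (w : hom Z (sh X)) :
  iso X X' -> iso Y Y' -> iso Z Z' -> dist u v w ->
  exists (u' : hom X' Y') (v' : hom Y' Z') (w' : hom Z' (sh X')),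
    dist u' v' w'.
Proof.
move=> [a [a' [a'a aa']]] [b [b' [b'b bb']]] [c [c' [c'c cc']]] d.
exists (b \oc u \oc a'), (c \oc v \oc b'), (fmap sh a \oc w \oc c').
apply: (dist_iso (a := a) (b := b) (c := c)) d.
- by exists a'.
- by exists b'.
- by exists c'.
- by rewrite -!compA a'a compm1.
- by rewrite -!compA b'b compm1.
- by rewrite -!compA c'c compm1.
Qed.

Lemma dist_unshift X Y Z (u : hom (sh X) (sh Y)) (v : hom (sh Y) (sh Z))
    (w : hom (sh Z) (sh (sh X))) :
  dist u v w ->
  exists (u' : hom X Y) (v' : hom Y Z) (w' : hom Z (sh X)), dist u' v' w'.
Proof.
have [u' u'E] := sh_surj (- u); have [v' v'E] := sh_surj (- v).
have [w' w'E] := sh_surj (- w); move=> d; exists u', v', w'.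
by apply/dist_sh; rewrite u'E v'E w'E !opprK.
Qed.

Lemma dist_unrot X Y Z (v : hom Y Z) (w : hom Z (sh X))
    (r : hom (sh X) (sh Y)) :
  dist v w r -> exists u : hom X Y, dist u v w.
Proof.
move=> d; have [u uE] := sh_surj (- r); exists u.
by apply/dist_rot; rewrite uE opprK.
Qed.

Lemma dist_cone_sh X Y (u : hom X Y) :
  exists (Z : C) (v : hom Y (sh Z)) (w : hom (sh Z) (sh X)), dist u v w.
Proof.
have [K [v [w d]]] := dist_cone u.
have [k [k' [k'k kk']]] := iso_sym (sh_unsh K).
exists (unsh K), (k \oc v), (w \oc k').
apply: (dist_iso (a := idm X) (b := idm Y) (c := k)) d.
- exact: is_iso_idm.
- exact: is_iso_idm.
- by exists k'.
- by rewrite comp1m compm1.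
- by rewrite compm1.
- by rewrite fmap1 comp1m -compA k'k compm1.
Qed.

Lemma dist_fiber Y Z (v : hom Y Z) :
  exists (X : C) (u : hom X Y) (w : hom Z (sh X)), dist u v w.
Proof.
have [X [w [r d]]] := dist_cone_sh v; have [u du] := dist_unrot d.
by exists X, u, w.
Qed.

Lemma dist_middle X Z (w : hom Z (sh X)) :
  exists (Y : C) (u : hom X Y) (v : hom Y Z), dist u v w.
Proof.
have [Y [r [t d]]] := dist_cone_sh w; have [v dv] := dist_unrot d.
by have [u du] := dist_unrot dv; exists Y, u, v.
Qed.

Lemma octahedron X Y Z Z' X' Y' (u : hom X Y) (v : hom Y Z)
    (i : hom Y Z') (i' : hom Z' (sh X)) (j : hom Z X') (j' : hom X' (sh Y))
    (k : hom Z Y') (k' : hom Y' (sh X)) :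
  dist u i i' -> dist v j j' -> dist (v \oc u) k k' ->
  exists (f : hom Z' Y') (g : hom Y' X') (h : hom X' (sh Z')), dist f g h.
Proof.
move=> d1 d2 d3; have [f [g [d _ _ _ _]]] := dist_oct d1 d2 d3.
by exists f, g, (fmap sh i \oc j').
Qed.

Lemma octahedron_fiber X Y Z A B K (a : hom A X) (u : hom X Y)
    (i : hom Y (sh A)) (b : hom B Y) (v : hom Y Z) (j : hom Z (sh B))
    (c : hom K X) (k : hom Z (sh K)) :
  dist a u i -> dist b v j -> dist c (v \oc u) k ->
  exists (f : hom A K) (g : hom K B) (h : hom B (sh A)), dist f g h.
Proof.
move=> /dist_rot d1 /dist_rot d2 /dist_rot d3.
by have [f [g [h /dist_unshift]]] := octahedron d1 d2 d3.
Qed.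

(** The part of the 3x3 lemma needed to glue decompositions: orthogonality
    lifts the connecting map of the given triangle to the left columns, and
    three octahedra produce the rest, passing through the pullback of [Y]
    along [LZ -> Z]. *)
Lemma glue_decompositions X Y Z LX RX LZ RZ
    (u : hom X Y) (v : hom Y Z) (w : hom Z (sh X))
    (lx : hom LX X) (rx : hom X RX) (dx : hom RX (sh LX))
    (lz : hom LZ Z) (rz : hom Z RZ) (dz : hom RZ (sh LZ)) :
  dist u v w -> dist lx rx dx -> dist lz rz dz -> hom0 LZ (sh RX) ->
  exists LY RY : C,
    [/\ exists (f : hom LX LY) (g : hom LY LZ) h, dist f g h,
        exists (f : hom LY Y) (g : hom Y RY) h, dist f g h
      & exists (f : hom RX RY) (g : hom RY RZ) h, dist f g h].
Proof.
move=> d dX dZ LR.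
(* [Y1] is the pullback of [Y] along [LZ -> Z]; the cone of [Y1 -> Y] is [RZ]. *)
have [Y1 [p [q dY1]]] := dist_middle (w \oc lz).
have [f1 [g1 [h1 dA]]] := octahedron dZ ((dist_rot _ _ _).1 ((dist_rot _ _ _).1 d))
  ((dist_rot _ _ _).1 ((dist_rot _ _ _).1 dY1)).
have [f2 [g2 [h2 {}dA]]] := dist_unshift ((dist_rot _ _ _).1 dA).
(* [LY] is glued from [LX] and [LZ]; the cone of [LY -> Y1] is [RX]. *)
have dshX := (dist_sh _ _ _).1 dX.
have [b bE] : exists b, w \oc lz = (- fmap sh lx) \oc b.
  by apply: (dist_lift dshX); rewrite compNm (LR (_ \oc _)) oppr0.
have [LY [s [t dLY]]] := dist_middle b.
move: dY1; rewrite bE => dY1.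
have [f3 [g3 [h3 dB]]] := octahedron ((dist_rot _ _ _).1 ((dist_rot _ _ _).1 dLY))
  dshX ((dist_rot _ _ _).1 ((dist_rot _ _ _).1 dY1)).
have [f4 [g4 [h4 {}dB]]] := dist_unshift dB.
have [RY [k [k' dY]]] := dist_cone (f2 \oc f4).
exists LY, RY; split.
- by exists s, t, b.
- by exists (f2 \oc f4), k, k'.
- exact: octahedron dB dA dY.
Qed.

(** * Split triangles and isomorphisms *)

Lemma dist_v0_retract X Y Z (u : hom X Y) (v : hom Y Z) (w : hom Z (sh X)) :
  dist u v w -> v = 0 -> retract Y X.
Proof.
move=> d v0; have [|g gE] := dist_lift (f := idm Y) d.
  by rewrite v0 comp0m.
by exists g, u.
Qed.

Lemma dist_u0_retract X Y Z (u : hom X Y) (v : hom Y Z) (w : hom Z (sh X)) :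
  dist u v w -> u = 0 -> retract Y Z.
Proof.
move=> d u0; have [|g gE] := dist_factor (f := idm Y) d.
  by rewrite u0 compm0.
by exists v, g.
Qed.

Lemma dist_mono X Y Z T (u : hom X Y) (v : hom Y Z) (w : hom Z (sh X))
    (f : hom T X) : dist u v w -> w = 0 -> u \oc f = 0 -> f = 0.
Proof.
move=> d w0 uf0; have [|g gE] := dist_extend_sh (f := idm (sh X)) d.
  by rewrite w0 compm0.
apply: sh_inj; rewrite fmap0 -[LHS]comp1m gE -compA -fmapM uf0 fmap0.
exact: compm0.
Qed.

Lemma dist_iso_of_zero X Y Z (u : hom X Y) (v : hom Y Z) (w : hom Z (sh X)) :
  dist u v w -> is_zero Z -> is_iso u.
Proof.
move=> d Z0; have w0 : w = 0 by exact: zero_eq0l.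
have [|g gE] := dist_lift (f := idm Y) d; first exact: zero_eq0.
exists g; split=> //; apply/eqP; rewrite -subr_eq0; apply/eqP.
apply: (dist_mono d w0).
by rewrite compDr compmN compm1 compA -gE comp1m subrr.
Qed.

(** Indexed by [bool], the splitting takes the form in which closure under
    small coproducts applies to it. *)
Lemma dist_w0_coproduct X Y Z (u : hom X Y) (v : hom Y Z) (w : hom Z (sh X)) :
  dist u v w -> w = 0 ->
  exists inj : forall b : bool, hom (if b then X else Z) Y, is_coproduct inj.
Proof.
move=> d w0.
have [|s sE] := dist_lift (f := idm Z) ((dist_rot _ _ _).1 d).
  by rewrite w0 comp0m.
have vu0 := dist_comp0 d.
have [|r rE] := dist_lift (f := idm Y - s \oc v) d.
  by rewrite compDr compm1 compmN compA -sE comp1m subrr.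
have ru : r \oc u = idm X.
  apply/eqP; rewrite -subr_eq0; apply/eqP; apply: (dist_mono d w0).
  rewrite compDr compmN compm1 compA -rE compDl compNm comp1m -compA vu0.
  by rewrite compm0 oppr0 addr0 subrr.
have rs : r \oc s = 0.
  apply: (dist_mono d w0).
  by rewrite compA -rE compDl compNm comp1m -compA -sE compm1 subrr.
exists (fun b : bool => if b return hom (if b then X else Z) Y then u else s).
move=> T f; exists (f true \oc r + f false \oc v); split=> [[]|h hP].
- by rewrite compDl -!compA ru vu0 compm0 compm1 addr0.
- by rewrite compDl -!compA rs -sE compm0 compm1 add0r.
- rewrite -(hP true) -(hP false) -!compA -compDr -rE.
  by rewrite addrNK compm1.
Qed.

(** * Coproducts *)

Lemma coproduct_eq (I : Type) (X : I -> C) S T (inj : forall i, hom (X i) S)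
    (f g : hom S T) :
  is_coproduct inj -> (forall i, f \oc inj i = g \oc inj i) -> f = g.
Proof.
move=> cop fg; have [h [_ hU]] := cop T (fun i => g \oc inj i).
by rewrite -(hU f fg) -(hU g).
Qed.

Lemma coproduct_retract (I : Type) (X Y : I -> C) S T
    (jX : forall i, hom (X i) S) (jY : forall i, hom (Y i) T) :
  is_coproduct jX -> is_coproduct jY -> (forall i, retract (X i) (Y i)) ->
  retract S T.
Proof.
move=> cX cY /dep_choice[s] /dep_choice[r] rs.
have [a [aP _]] := cX T (fun i => jY i \oc s i).
have [b [bP _]] := cY S (fun i => jX i \oc r i).
exists a, b; apply: coproduct_eq cX _ => i.
by rewrite -compA aP compA bP -compA rs compm1 comp1m.
Qed.

(** The cone of a coproduct of maps is the coproduct of their cones. Both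
    halves of the universal property are diagram chases in the long exact
    sequences of maps into [T], because a product of exact sequences of
    abelian groups is exact. *)
Lemma coproduct_cone (I : Type) (X Y Z : I -> C) (u : forall i, hom (X i) (Y i))
    (v : forall i, hom (Y i) (Z i)) (w : forall i, hom (Z i) (sh (X i)))
    (SX SY SZ : C) (jX : forall i, hom (X i) SX) (jY : forall i, hom (Y i) SY)
    (U : hom SX SY) (V : hom SY SZ) (W : hom SZ (sh SX)) :
  (forall i, dist (u i) (v i) (w i)) -> is_coproduct jX -> is_coproduct jY ->
  (forall i, U \oc jX i = jY i \oc u i) -> dist U V W ->
  exists k : forall i, hom (Z i) SZ,
    (forall i, k i \oc v i = V \oc jY i) /\ is_coproduct k.
Proof.
move=> d cX cY UE D.
have /dep_choice[k kP] : forall i, exists k : hom (Z i) SZ,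
    k \oc v i = V \oc jY i /\ fmap sh (jX i) \oc w i = W \oc k.
  by move=> i; apply: dist_mor (d i) D _; rewrite UE.
exists k; split=> [i|T f]; first by case: (kP i).
have cshX := (coproduct_sh _).1 cX; have cshY := (coproduct_sh _).1 cY.
have [g [gP _]] := cY T (fun i => f i \oc v i).
have [|h hE] := dist_factor (f := g) D.
  apply: coproduct_eq cX _ => i.
  by rewrite -compA UE compA gP -compA (dist_comp0 (d i)) compm0 comp0m.
have /dep_choice[e eP] : forall i, exists e : hom (sh (X i)) T,
    f i - h \oc k i = e \oc w i.
  move=> i; apply: dist_factor ((dist_rot _ _ _).1 (d i)) _.
  by rewrite compDl compNm -compA (kP i).1 compA -hE gP subrr.
have [E [EP _]] := cshX T e.
exists (h + E \oc W); split=> [i|h' h'P].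
  by rewrite compDl -compA -(kP i).2 compA EP -eP addrC subrK.
apply/eqP; rewrite -subr_eq0; apply/eqP.
set x := (h + E \oc W - h').
have xk i : x \oc k i = 0.
  rewrite /x !compDl compNm h'P -compA -(kP i).2 compA EP -eP.
  by rewrite (addrC (h \oc _)) subrK subrr.
have [|y yE] := dist_factor (f := x) ((dist_rot _ _ _).1 D).
  by apply: coproduct_eq cY _ => i; rewrite -compA -(kP i).1 compA xk !comp0m.
have /dep_choice[z zP] : forall i, exists z : hom (sh (Y i)) T,
    y \oc fmap sh (jX i) = z \oc fmap sh (u i).
  by move=> i; apply: dist_extend_sh (d i) _; rewrite -compA (kP i).2 compA -yE.
have [t [tP _]] := cshY T z.
have -> : x = t \oc fmap sh U \oc W.
  rewrite yE; congr (_ \oc W); apply: coproduct_eq cshX _ => i.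
  by rewrite -compA -fmapM UE fmapM compA tP zP.
have := dist_comp0 ((dist_rot _ _ _).1 ((dist_rot _ _ _).1 D)).
by rewrite compNm -compA => /eqP; rewrite oppr_eq0 => /eqP ->; rewrite compm0.
Qed.

Lemma coproduct_fiber (I : Type) (X Y Z : I -> C) (u : forall i, hom (X i) (Y i))
    (v : forall i, hom (Y i) (Z i)) (w : forall i, hom (Z i) (sh (X i)))
    (SX SY SZ : C) (jY : forall i, hom (Y i) SY) (jZ : forall i, hom (Z i) SZ)
    (U : hom SX SY) (V : hom SY SZ) (W : hom SZ (sh SX)) :
  (forall i, dist (u i) (v i) (w i)) -> is_coproduct jY -> is_coproduct jZ ->
  (forall i, V \oc jY i = jZ i \oc v i) -> dist U V W ->
  exists k : forall i, hom (X i) SX, is_coproduct k.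
Proof.
move=> d cY cZ VE D.
have [k [_ kP]] := coproduct_cone (fun i => (dist_rot _ _ _).1 (d i)) cY cZ VE
  ((dist_rot _ _ _).1 D).
have /dep_choice[k' k'E] : forall i, exists k' : hom (X i) SX, fmap sh k' = k i.
  by move=> i; exact: sh_surj.
exists k'; apply/coproduct_sh.
by have -> : (fun i => fmap sh (k' i)) = k by apply: functional_extensionality_dep.
Qed.

Lemma coproduct_unsh (I : Type) (X : I -> C) S (inj : forall i, hom (X i) S) :
  is_coproduct inj ->
  exists inj' : forall i, hom (unsh (X i)) (unsh S), is_coproduct inj'.
Proof.
move=> cop.
have /dep_choice[a aP] : forall i, exists a : hom (X i) (sh (unsh (X i))),
  is_iso a by move=> i; exact: iso_sym (sh_unsh _).
have [s sP] := iso_sym (sh_unsh S).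
have /dep_choice[inj' injE] : forall i, exists j : hom (unsh (X i)) (unsh S),
    s \oc inj i = fmap sh j \oc a i.
  move=> i; have [a' [a'a aa']] := aP i.
  have [j jE] := sh_surj (s \oc inj i \oc a').
  by exists j; rewrite jE -compA a'a compm1.
exists inj'; apply/coproduct_sh; exact: coproduct_iso aP sP injE cop.
Qed.

End Triangles.

Section Classes.
Local Open Scope ring_scope.
Variable C : tricat.
Implicit Types (X Y Z M N : C) (P D E : set C) (A : Type) (I J : set int).

(** * Shifts *)

Lemma shiftz_iso i X Y : iso X Y -> iso (shiftz i X) (shiftz i Y).
Proof.
case: i => n; elim: n => [|n IH] XY //=; try exact: fobj_iso (IH XY).
- exact: unsh_iso.
- exact: unsh_iso (IH XY).
Qed.

Lemma shiftzD i j M : iso (shiftz i (shiftz j M)) (shiftz (i + j) M).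
Proof.
elim/int_ind: i => [|n IH|n IH]; first by rewrite add0r; exact: iso_refl.
- rewrite (_ : Posz n.+1 + j = Posz n + j + 1); last by lia.
  exact: iso_trans (fobj_iso sh IH) (sh_shiftz _ _).
- have -> : - Posz n.+1 = - Posz n - 1 by lia.
  apply: iso_trans (iso_sym (unsh_shiftz _ _)) _.
  rewrite (_ : - Posz n - 1 + j = - Posz n + j - 1); last by lia.
  exact: iso_trans (unsh_iso IH) (unsh_shiftz _ _).
Qed.

Lemma shift_class_sub i P M : P M -> shift_class i P (shiftz i M).
Proof. by move=> PM; exists M => //; exact: iso_refl. Qed.

Lemma shift_class0 P : P `<=` shift_class 0 P.
Proof. by move=> M PM; exact: (@shift_class_sub 0). Qed.

Lemma shift_classD i j P M : shift_class i P M -> shift_class (j + i) P (shiftz j M).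
Proof.
move=> [N PN MN]; exists N => //.
exact: iso_trans (shiftz_iso j MN) (shiftzD _ _ _).
Qed.

Lemma shift_class1P D M : (forall X Y, iso X Y -> D X -> D Y) ->
  shift_class 1 D M <-> D (unsh M).
Proof.
move=> Diso; split=> [[N DN MN]|DM].
  exact: Diso (iso_trans (iso_sym (unsh_sh N)) (iso_sym (unsh_iso MN))) DN.
by exists (unsh M) => //; exact/iso_sym/sh_unsh.
Qed.

Lemma hom0_iso X X' Y Y' : iso X X' -> iso Y Y' -> hom0 X Y -> hom0 X' Y'.
Proof.
move=> [a [a' [_ aa']]] [b [b' [_ bb']]] XY f.
have -> : f = b \oc (b' \oc f \oc a) \oc a'.
  by rewrite !compA bb' comp1m -compA aa' compm1.
by rewrite (XY (_ \oc a)) compm0 comp0m.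
Qed.

Lemma hom0_sh X Y : hom0 (sh X) (sh Y) <-> hom0 X Y.
Proof.
split=> XY f; first by apply: sh_inj; rewrite fmap0.
by have [g <-] := sh_surj f; rewrite (XY g) fmap0.
Qed.

Lemma hom0_shiftz i X Y : hom0 (shiftz i X) (shiftz i Y) <-> hom0 X Y.
Proof.
have unshE M N : hom0 (unsh M) (unsh N) <-> hom0 M N.
  rewrite -hom0_sh; split; apply: hom0_iso; try exact: sh_unsh.
    exact/iso_sym/sh_unsh.
  exact/iso_sym/sh_unsh.
case: i => n; elim: n => [|n IH]; [by []|exact: iff_trans (hom0_sh _ _) IH| |].
  exact: unshE.
exact: iff_trans (unshE _ _) IH.
Qed.

Lemma hom0_shiftz_adj i X Y : hom0 (shiftz i X) Y <-> hom0 X (shiftz (- i) Y).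
Proof.
rewrite -(hom0_shiftz i X).
have YE : iso (shiftz i (shiftz (- i) Y)) Y.
  by apply: iso_trans (shiftzD _ _ _) _; rewrite subrr; exact: iso_refl.
by split; apply: hom0_iso (iso_refl _) _; first exact: iso_sym.
Qed.

(** * Extension-closed and smashing classes *)

Definition ext_smashing A D := extension_closed D /\ class_smashing A D.

Lemma gen_ext_smashing A P : ext_smashing A (gen A P).
Proof. by split; [exact: gen_extension|exact: gen_smashing]. Qed.

Lemma gen_min A P D : ext_smashing A D -> P `<=` D -> gen A P `<=` D.
Proof. by move=> [De Ds] PD M; apply. Qed.

Lemma ext_smashing_sh A D :
  ext_smashing A D -> ext_smashing A [set M | D (sh M)].
Proof.
move=> [De Ds]; split; first split=> [Z Z0|X Y Z u v w].
- by apply: De.1; exact: fobj_zero.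
- by move=> /dist_sh; exact: De.2.
- move=> I X S inj IA /coproduct_sh cop; exact: Ds cop.
Qed.

Lemma ext_smashing_unsh A D :
  ext_smashing A D -> ext_smashing A [set M | D (unsh M)].
Proof.
move=> [De Ds]; split; first split=> [Z Z0|X Y Z u v w d].
- by apply: De.1; exact: unsh_zero.
- have [u' [v' [w' d']]] := dist_transport (iso_sym (sh_unsh X))
    (iso_sym (sh_unsh Y)) (iso_sym (sh_unsh Z)) d.
  by have [u2 [v2 [w2]]] := dist_unshift d'; exact: De.2.
- by move=> I X S inj IA /coproduct_unsh[inj']; exact: Ds.
Qed.

Lemma ext_smashing_iso A D X Y : ext_smashing A D -> iso X Y -> D X -> D Y.
Proof. by move=> [De _]; exact: extension_iso. Qed.

Lemma ext_smashing_shift1 A D :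
  ext_smashing A D -> ext_smashing A (shift_class 1 D).
Proof.
move=> DE; have [De Ds] := ext_smashing_unsh DE.
have DP M : shift_class 1 D M <-> D (unsh M).
  by apply: shift_class1P => X Y; exact: (ext_smashing_iso DE).
split; first split=> [Z Z0|X Y Z u v w d].
- by apply/DP; exact: De.1.
- by move=> /DP DX /DP DZ; apply/DP; exact: De.2 d DX DZ.
- by move=> I X S inj IA cop DX; apply/DP; apply: (Ds _ _ _ _ IA cop) => i; exact/DP.
Qed.

(** A map out of a coproduct is a family of maps, whatever the number of
    summands. *)
Lemma ext_smashing_left_orth A E :
  ext_smashing A [set M | forall N, E N -> hom0 M N].
Proof.
split; first split=> [Z Z0 N _ f|X Y Z u v w d hX hZ N EN f].
- exact: zero_eq0l.
- have [|g ->] := dist_factor (f := f) d; first exact: hX.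
  by rewrite (hZ _ EN g) comp0m.
- move=> I X S inj _ cop hX N EN f; apply: coproduct_eq cop _ => i.
  by rewrite comp0m; exact: hX.
Qed.

Lemma extension_right_orth E :
  extension_closed [set N | forall M, E M -> hom0 M N].
Proof.
split=> [Z Z0 N _ f|X Y Z u v w d hX hZ M EM f]; first exact: zero_eq0.
have [|g ->] := dist_lift (f := f) d; first exact: hZ.
by rewrite (hX _ EM g) compm0.
Qed.

(** * Classes generated by shifts of a given class *)

Definition gen_shifts A P I : set C := gen A (\bigcup_(i in I) shift_class i P).

Lemma gen_shifts_sub A P I i : I i -> shift_class i P `<=` gen_shifts A P I.
Proof. by move=> Ii M PM; apply: gen_sub; exists i. Qed.

Lemma gen_shifts_le A P I J : I `<=` J -> gen_shifts A P I `<=` gen_shifts A P J.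
Proof.
move=> IJ; apply: gen_min; first exact: gen_ext_smashing.
by move=> M [i Ii]; apply: gen_shifts_sub; exact: IJ.
Qed.

Lemma gen_shifts_iso A P I X Y :
  iso X Y -> gen_shifts A P I X -> gen_shifts A P I Y.
Proof. exact: ext_smashing_iso (gen_ext_smashing _ _). Qed.

Lemma gen_shifts_sh A P I J : (forall i, I i -> J (i + 1)) ->
  forall M, gen_shifts A P I M -> gen_shifts A P J (sh M).
Proof.
move=> IJ; apply: gen_min.
  exact: (ext_smashing_sh (gen_ext_smashing _ _)).
move=> M [i Ii PM]; apply: (gen_shifts_sub (IJ i Ii)).
by rewrite addrC; exact: (shift_classD 1 PM).
Qed.

Lemma gen_shifts_unsh A P I J : (forall i, I i -> J (i - 1)) ->
  forall M, gen_shifts A P I M -> gen_shifts A P J (unsh M).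
Proof.
move=> IJ; apply: gen_min.
  exact: (ext_smashing_unsh (gen_ext_smashing _ _)).
move=> M [i Ii PM]; apply: (gen_shifts_sub (IJ i Ii)).
by rewrite addrC; exact: (shift_classD (Negz 0) PM).
Qed.

Lemma gen_shifts_shiftz A P I J j : (forall i, I i -> J (i + j)) ->
  forall M, gen_shifts A P I M -> gen_shifts A P J (shiftz j M).
Proof.
elim/int_ind: j J => [|n IH|n IH] J IJ M gM.
- by apply: gen_shifts_le gM => i; rewrite -[i in J i]addr0; exact: IJ.
- apply: (@gen_shifts_sh A P [set i | J (i + 1)]) => //.
  by apply: IH gM => i Ii /=; rewrite -addrA -PoszD addn1; exact: IJ.
- have -> : - Posz n.+1 = - Posz n - 1 by lia.
  apply: gen_shifts_iso (unsh_shiftz _ _) _.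
  apply: (@gen_shifts_unsh A P [set i | J (i - 1)]) => //.
  apply: IH gM => i Ii /=.
  by rewrite (_ : i - Posz n - 1 = i + - Posz n.+1); [exact: IJ|lia].
Qed.

Definition from (i : int) : set int := [set j | i <= j].
Definition upto (i : int) : set int := [set j | j <= i].

Lemma gen_from_succP A P i M :
  gen_shifts A P (from (i + 1)) M <-> shift_class 1 (gen_shifts A P (from i)) M.
Proof.
rewrite shift_class1P; last exact: gen_shifts_iso.
split; first by apply: gen_shifts_unsh => j; rewrite /from /=; lia.
move=> gM; apply: gen_shifts_iso (sh_unsh M) _; move: gM.
by apply: gen_shifts_sh => j; rewrite /from /=; lia.
Qed.

Lemma negative_shifts A P i j : negative A P -> i < j ->
  orth (shift_class i P) (gen_shifts A P (from j)).
Proof.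
move=> Pneg ij M N [M' PM' MM'] gN.
apply: hom0_iso (iso_sym MM') (iso_refl N) _.
apply/hom0_shiftz_adj => f; apply: Pneg PM' _ f.
by apply: gen_shifts_shiftz gN => k; rewrite /from /=; lia.
Qed.

Lemma negative_upto A P i j : negative A P -> i < j ->
  orth (gen_shifts A P (upto i)) (gen_shifts A P (from j)).
Proof.
move=> Pneg ij M N + gN; move: M.
suff : gen_shifts A P (upto i) `<=`
    [set M | forall N, gen_shifts A P (from j) N -> hom0 M N].
  by move=> sub M gM; exact: sub.
apply: gen_min; first exact: ext_smashing_left_orth.
move=> M [k ki PM] L gL f; apply: negative_shifts PM gL f => //.
exact: Order.POrderTheory.le_lt_trans ij.
Qed.

(** * Weight decompositions *)

Definition decomposable (L R : set C) : set C :=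
  [set M | exists (X Y : C) (u : hom X M) (v : hom M Y) (w : hom Y (sh X)),
     [/\ dist u v w, L X & R Y]].

(** Hence decompositions of generators suffice for those of a generated class:
    triangles with terms in [L] and [R] can be added up, and they can be glued
    along extensions since [L] is orthogonal to [R[1]]. *)
Lemma ext_smashing_decomposable A (L R : set C) : smashing C A ->
  ext_smashing A L -> ext_smashing A R ->
  (forall X Y, L X -> R Y -> hom0 X (sh Y)) ->
  ext_smashing A (decomposable L R).
Proof.
move=> CA [Le Ls] [Re Rs] LR; split; first split.
- move=> Z Z0; exists Z, Z, (idm Z), 0, 0; split; first exact: dist_id.
    exact: Le.1.
  exact: Re.1.
- move=> X Y Z u v w d [LX [RX [lx [rx [dx [dX LLX RRX]]]]]].
  move=> [LZ [RZ [lz [rz [dz [dZ LLZ RRZ]]]]]].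
  have [LY [RY [[? [? [? dL]]] [f [g [h dY]]] [? [? [? dR]]]]]] :=
    glue_decompositions d dX dZ (LR _ _ LLZ RRX).
  exists LY, RY, f, g, h; split=> //; first exact: Le.2 dL LLX LLZ.
  exact: Re.2 dR RRX RRZ.
- move=> I M S jM IA cM dM.
  have /dep_choice[X] := dM.
  move=> /dep_choice[Y] /dep_choice[u] /dep_choice[v] /dep_choice[w] d.
  have [SX [jX cX]] := CA I X IA.
  have [U [UP _]] := cX S (fun i => jM i \oc u i).
  have [SY [V [W D]]] := dist_cone U.
  have di i : dist (u i) (v i) (w i) by case: (d i).
  have [k [_ cY]] := coproduct_cone di cX cM UP D.
  exists SX, SY, U, V, W; split=> //.
    by apply: Ls IA cX _ => i; case: (d i).
  by apply: Rs IA cY _ => i; case: (d i).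
Qed.

(** * Retracts *)

(** The Eilenberg swindle. If [e = i p] is the idempotent of a retract [X] of
    [Y] then, with [Y = X + Z], shifting the copies of [X] in the countable
    coproduct [S] of copies of [Y] is a split monomorphism with cokernel the
    first copy of [X]. *)
Lemma swindle X Y S (inj : nat -> hom Y S) : retract X Y -> is_coproduct inj ->
  is_biproduct S X S.
Proof.
move=> [i [p pi1]] cop.
have [e eE] : exists e, e = i \oc p by exists (i \oc p).
have ee : e \oc e = e by rewrite eE -compA (compA p) pi1 comp1m.
have e0 : e \oc (idm Y - e) = 0 by rewrite compDr compmN ee compm1 subrr.
have e0' : (idm Y - e) \oc e = 0 by rewrite compDl compNm ee comp1m subrr.
have e1 : (idm Y - e) \oc (idm Y - e) = idm Y - e.
  by rewrite compDl compNm e0 comp1m subr0.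
(* [phi] is the shift of the copies of [X], [psi] the backward shift, which
   drops the first copy, and [q] the projection to this copy. *)
have [phi [phiE _]] := cop S (fun n => inj n \oc (idm Y - e) + inj n.+1 \oc e).
have [psi [psiE _]] := cop S (fun n => inj n \oc (idm Y - e) +
  if n is m.+1 then inj m \oc e else 0).
have psiS n : psi \oc inj n.+1 = inj n.+1 \oc (idm Y - e) + inj n \oc e.
  exact: psiE.
have [q [qE _]] := cop X (fun n => if n is 0%N then p else 0).
have qS n : q \oc inj n.+1 = 0 by exact: qE.
exists phi, (inj 0%N \oc i), psi, q; split.
- apply: coproduct_eq cop _ => n; rewrite comp1m -compA phiE compDr !compA psiS psiE.
  rewrite !compDl -!compA e1 e0' ee compm0 add0r.
  rewrite (_ : (if n is m.+1 then inj m \oc e else 0) \oc (idm Y - e) = 0).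
    by rewrite addr0 -compDr subrK compm1.
  by case: n => [|n]; rewrite ?comp0m// -compA e0 compm0.
- by rewrite compA qE.
- apply: coproduct_eq cop _ => n; rewrite comp0m -compA phiE compDr !compA qS qE.
  rewrite comp0m addr0; case: n => [|n]; last by rewrite comp0m.
  by rewrite compDr compm1 compmN eE compA pi1 comp1m subrr.
- rewrite compA psiE addr0 -compA compDl compNm comp1m eE -compA pi1 compm1.
  by rewrite subrr compm0.
- apply: coproduct_eq cop _ => n; rewrite comp1m compDl -!compA psiE qE compDr.
  rewrite compA phiE compDl -!compA e1 e0 compm0 addr0.
  case: n => [|n]; rewrite ?compm0 ?addr0.
    by rewrite -eE -compDr subrK compm1.
  rewrite compA phiE compDl -!compA e0' ee compm0 add0r.
  by rewrite -compDr subrK compm1.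
Qed.

Lemma biproduct_sym X Y S : is_biproduct X Y S -> is_biproduct Y X S.
Proof.
move=> [i1 [i2 [p1 [p2 [? ? ? ? sumE]]]]].
by exists i2, i1, p2, p1; split; rewrite // addrC.
Qed.

Lemma retract_closed_sh A D : smashing C A -> card_lt nat A ->
  ext_smashing A D -> (forall M, D M -> D (sh M)) -> retract_closed D.
Proof.
move=> CA natA DE Dsh X Y XY DY.
have [S [inj cop]] := CA nat (fun=> Y) natA.
have DS : D S by apply: DE.2 natA cop _.
have [Z [u [v [w [d XZ]]]]] := biproduct_dist (swindle XY cop).
apply: (ext_smashing_iso DE (iso_sym XZ)).
exact: DE.1.2 ((dist_rot _ _ _).1 d) DS (Dsh _ DS).
Qed.

Lemma retract_closed_unsh A D : smashing C A -> card_lt nat A ->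
  ext_smashing A D -> (forall M, D M -> D (unsh M)) -> retract_closed D.
Proof.
move=> CA natA DE Dunsh X Y XY DY.
have [S [inj cop]] := CA nat (fun=> Y) natA.
have DS : D S by apply: DE.2 natA cop _.
have [Z [u [v [w [d SZ]]]]] := biproduct_dist (biproduct_sym (swindle XY cop)).
have [u' [v' [w' d']]] := dist_transport (iso_refl X) (iso_refl S)
  (iso_trans (iso_sym SZ) (iso_sym (sh_unsh S))) d.
by have [t dt] := dist_unrot d'; exact: DE.1.2 dt (Dunsh _ DS) DS.
Qed.

End Classes.

(** * Weight structures *)

Section Weights.
Local Open Scope ring_scope.
Variable C : tricat.
Implicit Types (X Y Z M N : C) (P Q D E : set C) (A : Type) (I J : set int).
Implicit Types w : weight_structure C.

Lemma retract_iso X Y : iso X Y -> retract X Y.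
Proof. by move=> [f [g [gf _]]]; exists f, g. Qed.

Lemma wle_iso w X Y : iso X Y -> wle w X -> wle w Y.
Proof. by move=> XY; exact: wle_retract (retract_iso (iso_sym XY)). Qed.

Lemma wge_iso w X Y : iso X Y -> wge w X -> wge w Y.
Proof. by move=> XY; exact: wge_retract (retract_iso (iso_sym XY)). Qed.

Lemma wge_sh w M : wge w M -> wge w (sh M).
Proof. by move=> wM; apply: wge_shift; exact: (shift_class_sub 1 wM). Qed.

Lemma wle_unsh w M : wle w M -> wle w (unsh M).
Proof. by move=> /wle_shift; rewrite shift_class1P => // X Y; exact: wle_iso. Qed.

Lemma wleE w :
  wle w = [set M | forall N, shift_class 1 (wge w) N -> hom0 M N].
Proof.
apply/seteqP; split=> [M wM N wN f|M MN]; first exact: w_orth wM wN f.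
have [L [R [u [v [d [D wL wR]]]]]] := w_decomp w M.
exact: wle_retract (dist_v0_retract D (MN _ wR v)) wL.
Qed.

(** This is the weight decomposition of [M[1]], shifted back. *)
Lemma w_decomp_sh w M : exists (L R : C) (u : hom L M) (v : hom M R) t,
  [/\ dist u v t, wle w (sh L) & wge w R].
Proof.
have [L [R [u [v [d [D wL [R' wR' RR']]]]]]] := w_decomp w (sh M).
have [? [? [? /dist_unshift[u' [v' [t' D']]]]]] :=
  dist_transport (iso_sym (sh_unsh L)) (iso_refl _) RR' D.
exists (unsh L), R', u', v', t'; split=> //.
exact: wle_iso (iso_sym (sh_unsh L)) wL.
Qed.

Lemma wgeE w : wge w = [set N | forall M, wle w M -> hom0 M (sh N)].
Proof.
apply/seteqP; split=> [N wN M wM f|N MN].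
  exact: w_orth wM (shift_class_sub 1 wN) f.
have [L [R [u [v [d [D wL wR]]]]]] := w_decomp_sh w N.
have LN : hom0 L N by apply/hom0_sh; exact: MN.
exact: wge_retract (dist_u0_retract D (LN u)) wR.
Qed.

Lemma ext_smashing_wle A w : ext_smashing A (wle w).
Proof. by rewrite wleE; exact: ext_smashing_left_orth. Qed.

Lemma extension_wge w : extension_closed (wge w).
Proof.
have [E0 Eext] := extension_right_orth (wle w).
rewrite wgeE; split=> [Z Z0|X Y Z u v t /dist_sh]; last exact: Eext.
by apply: E0; exact: fobj_zero.
Qed.

(** Each half of a weight structure determines the other by orthogonality, so
    no weight structure properly contains another. *)
Lemma weight_structure_incl w w' :
  wle w `<=` wle w' -> wge w `<=` wge w' -> wle w' = wle w /\ wge w' = wge w.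
Proof.
move=> le ge; split; apply/seteqP; split=> //.
  rewrite !wleE => M MN N [N' wN' NN']; apply: MN.
  by exists N' => //; exact: ge.
by rewrite !wgeE => N MN M wM; apply: MN; exact: le.
Qed.

Lemma gen_upto_wle A P w : P `<=` wle w -> gen_shifts A P (upto 0) `<=` wle w.
Proof.
move=> Pw; apply: gen_min; first exact: ext_smashing_wle.
move=> M [i i0 [N PN MN]]; apply: wle_iso (iso_sym MN) _.
elim/int_ind: i i0 {M MN} => [_|n _ //|n IH _]; first exact: Pw.
have -> : - Posz n.+1 = - Posz n - 1 by lia.
apply: wle_iso (unsh_shiftz _ _) _; apply: wle_unsh; apply: IH.
by rewrite /upto /=; lia.
Qed.

Lemma gen_from_wge A P w : class_smashing A (wge w) -> P `<=` wge w ->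
  gen_shifts A P (from 0) `<=` wge w.
Proof.
move=> wA Pw; apply: gen_min; first by split=> //; exact: extension_wge.
move=> M [[n|//] _ [N PN MN]]; apply: wge_iso (iso_sym MN) _.
by elim: n {M MN} => [|n IH]; [exact: Pw|exact: wge_sh].
Qed.

Lemma decomposable_left (L R : set C) M :
  extension_closed R -> L M -> decomposable L R M.
Proof.
move=> Re LM; have [O O0] := has_zero C.
exists M, O, (idm M), 0, 0; split=> //; first exact: dist_id.
exact: Re.1.
Qed.

Lemma decomposable_right (L R : set C) M :
  extension_closed L -> R M -> decomposable L R M.
Proof.
move=> Le RM; have [O O0] := has_zero C.
exists O, M, 0, (idm M), 0; split=> //; last exact: Le.1.
by apply/dist_rot; rewrite fmap0 oppr0; exact: dist_id (fobj_zero sh O0).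
Qed.

(** Negativity is the orthogonality axiom for the generated classes, closure
    under retracts is the swindle, and weight decompositions of the shifts of
    [P], which are trivial, propagate to all objects. *)
Lemma weight_structure_of_negative A P : smashing C A -> card_lt nat A ->
  negative A P -> (forall M, loc A P M) ->
  exists w, wge w = gen_shifts A P (from 0) /\ wle w = gen_shifts A P (upto 0).
Proof.
move=> CA natA Pneg locP.
set ge := gen_shifts A P (from 0); set le := gen_shifts A P (upto 0).
have geE : ext_smashing A ge by exact: gen_ext_smashing.
have leE : ext_smashing A le by exact: gen_ext_smashing.
have ge_sh M : ge M -> ge (sh M).
  by apply: gen_shifts_sh => i; rewrite /from /=; lia.
have le_unsh M : le M -> le (unsh M).
  by apply: gen_shifts_unsh => i; rewrite /upto /=; lia.
have ge1E N : shift_class 1 ge N <-> gen_shifts A P (from 1) N.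
  exact: iff_sym (gen_from_succP A P 0 N).
have lege : orth le (shift_class 1 ge).
  move=> M N leM /ge1E geN; exact: (negative_upto Pneg _ leM geN).
have ge_retract := retract_closed_sh CA natA geE ge_sh.
have le_retract := retract_closed_unsh CA natA leE le_unsh.
have le_shift : le `<=` shift_class 1 le.
  move=> M /le_unsh leM; apply/shift_class1P => // X Y.
  exact: gen_shifts_iso.
have ge_shift : shift_class 1 ge `<=` ge.
  by move=> M /ge1E; apply: gen_shifts_le => i; rewrite /from /=; lia.
have dec M : decomposable le (shift_class 1 ge) M.
  have R1 : ext_smashing A (shift_class 1 ge) by exact: ext_smashing_shift1.
  apply: gen_min (locP M).
    apply: ext_smashing_decomposable => // X Y leX geY.
    by move=> f; exact: lege leX (shift_class_sub 1 (ge_shift _ geY)) f.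
  move=> X [i _ PX]; have [i0|i0] := lerP i 0.
    by apply: decomposable_left R1.1 _; exact: gen_shifts_sub PX.
  apply: decomposable_right leE.1 _; apply/ge1E.
  by apply: gen_shifts_sub PX; rewrite /from /=; lia.
by exists (WeightStructure le_retract ge_retract le_shift ge_shift lege dec).
Qed.

(** * Weight structures generated by a class *)

Section Generated.
Variables (A : Type) (P : set C) (w : weight_structure C).
Hypothesis wP : w_smashing_generated A P w.

Let CA : smashing C A. Proof. by case: wP. Qed.

Lemma generated_wge : wge w = gen_shifts A P (from 0).
Proof. by case: wP. Qed.

Lemma generated_wle : wle w = gen_shifts A P (upto 0).
Proof. by case: wP. Qed.

Lemma generated_heart : P `<=` heart w.
Proof.
move=> M PM; split; rewrite ?generated_wge ?generated_wle.
  exact: gen_shifts_sub (shift_class0 PM).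
exact: gen_shifts_sub (shift_class0 PM).
Qed.

Lemma generated_smashing : w_smashing A w.
Proof. by split=> //; rewrite generated_wge; exact: gen_smashing. Qed.

Lemma generated_negative : negative A P.
Proof.
move=> M N PM gN; apply: w_orth (generated_heart PM).1 _.
by rewrite generated_wge; exact/gen_from_succP.
Qed.

Lemma generated_loc M : loc A P M.
Proof.
have [L [R [u [v [d [D wL wR]]]]]] := w_decomp w M.
apply: (gen_extension A _).2 D _ _.
  by move: wL; rewrite generated_wle; exact: gen_shifts_le.
move: wR; rewrite generated_wge => /gen_from_succP.
exact: gen_shifts_le.
Qed.

(** An object of arbitrarily high weights receives no maps from the shifts of
    [P], hence none from the category that they generate, which contains the
    object itself. *)
Lemma generated_left_nondegenerate : left_nondegenerate w.
Proof.
move=> M Mw; suff : [set X | forall N, [set M] N -> hom0 X N] M.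
  by move=> /(_ M erefl (idm M)).
apply: gen_min (generated_loc M); first exact: ext_smashing_left_orth.
move=> X [i _ PX] _ -> f.
apply: (negative_shifts (j := i + 1) generated_negative _ PX); first by lia.
have [N wN MN] := Mw (i + 1); apply: gen_shifts_iso (iso_sym MN) _.
move: wN; rewrite generated_wge; apply: gen_shifts_shiftz => j.
by rewrite /from /=; lia.
Qed.

(** Being orthogonal to the negative shifts of [P] propagates from these to
    all of [wle w] shifted by -1, and [wge w] is the orthogonal of the latter. *)
Lemma generated_w_generated : w_generated P w.
Proof.
apply/seteqP; split=> [N wN M _ [i i0 PM] -> f|N NP].
  by apply: (negative_shifts generated_negative i0 PM); rewrite -generated_wge.
rewrite wgeE => M; rewrite generated_wle => gM.
suff : [set X | forall Y, [set sh N] Y -> hom0 X Y] M by apply.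
apply: gen_min gM; first exact: ext_smashing_left_orth.
move=> X [i i0 PX] _ ->; apply: hom0_iso (sh_unsh X) (iso_refl _) _.
apply/hom0_sh => f; apply: NP => //; exists (i - 1); last first.
  by rewrite addrC; exact: (shift_classD (Negz 0) PX).
by move: i0; rewrite /upto /=; lia.
Qed.

End Generated.

(** * Small coproducts and the heart *)

Lemma coproduct_sigma (I : Type) (J : I -> Type) (X : forall i, J i -> C)
    (S : I -> C) T (inj : forall i j, hom (X i j) (S i))
    (jS : forall i, hom (S i) T) :
  (forall i, is_coproduct (inj i)) -> is_coproduct jS ->
  is_coproduct (fun p : {i : I & J i} =>
    jS (projT1 p) \oc inj (projT1 p) (projT2 p)).
Proof.
move=> cS cT U f.
have /dep_choice[g gP] : forall i, exists g : hom (S i) U,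
    forall j, g \oc inj i j = f (existT _ i j).
  by move=> i; have [g [gP _]] := cS i U (fun j => f (existT _ i j)); exists g.
have [h [hP hU]] := cT U g; exists h; split=> [[i j]|h' h'P].
  by rewrite compA hP gP.
apply: hU => i; apply: coproduct_eq (cS i) _ => j.
by rewrite gP -compA (h'P (existT _ i j)).
Qed.

Lemma small_coproducts_sub A P :
  [set: nat] #<= [set: A] -> P `<=` small_coproducts A P.
Proof.
move=> natA M PM; exists unit, (fun=> M), (fun=> idm M); split=> //.
  exact: card_lt_finite.
move=> T f; exists (f tt); split=> [[]|g gP]; first by rewrite compm1.
by rewrite -(gP tt) compm1.
Qed.

Lemma small_coproducts_smashing A P :
  infinite_regular A -> class_smashing A (small_coproducts A P).
Proof.
move=> [_ reg] I X S inj IA cop /dep_choice[J] /dep_choice[Y] /dep_choice[k] kP.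
exists {i : I & J i}, (fun p => Y (projT1 p) (projT2 p)).
exists (fun p => inj (projT1 p) \oc k (projT1 p) (projT2 p)); split.
- by apply: reg => // i; case: (kP i).
- by move=> [i j]; case: (kP i) => _ /(_ j).
- by apply: coproduct_sigma cop => i; case: (kP i).
Qed.

Lemma small_coproducts_min A P D :
  class_smashing A D -> P `<=` D -> small_coproducts A P `<=` D.
Proof.
move=> Ds PD S [I [X [inj [IA PX cop]]]]; apply: Ds IA cop _ => i.
exact: PD.
Qed.

Lemma small_coproducts_shifts A P I :
  gen_shifts A (small_coproducts A P) I `<=` gen_shifts A P I.
Proof.
apply: gen_min; first exact: gen_ext_smashing.
move=> M [i Ii [S QS MS]]; apply: gen_shifts_iso (iso_sym MS) _.
apply: (@gen_shifts_shiftz C A P [set 0]) => [_ ->|]; first by rewrite add0r.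
apply: small_coproducts_min QS; first exact: gen_smashing.
by move=> X PX; apply: (gen_shifts_sub _ (shift_class0 PX)).
Qed.

Lemma negative_small_coproducts A P :
  negative A P -> negative A (small_coproducts A P).
Proof.
move=> Pneg M N QM /small_coproducts_shifts gN.
suff : [set X | forall Y, gen_shifts A P (from 1) Y -> hom0 X Y] M by apply.
apply: small_coproducts_min QM; first exact: (ext_smashing_left_orth _ _).2.
by move=> X PX Y gY f; exact: Pneg PX gY f.
Qed.

(** Extensions inside a negative class split, so only sums matter. *)
Lemma ext_smashing_negative A Q : [set: nat] #<= [set: A] ->
  class_smashing A Q -> negative A Q -> ext_smashing A Q.
Proof.
move=> natA Qs Qneg; split=> //; split=> [Z Z0|X Y Z u v w d QX QZ].
  apply: (Qs void (fun=> Z) Z (fun x => match x with end)) => //.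
    exact: card_lt_finite.
  by move=> T f; exists 0; split=> [[]|g _]; rewrite (zero_eq0l g Z0).
have w0 : w = 0.
  apply: Qneg QZ _ _; apply: (@gen_shifts_sub C A Q (from 1) 1) => //.
  exact: (shift_class_sub 1 QX).
have [inj cop] := dist_w0_coproduct d w0.
by apply: (Qs bool _ Y inj _ cop) => [|[]//]; exact: card_lt_finite.
Qed.

Lemma ext_smashing_shift A D n :
  ext_smashing A D -> ext_smashing A (shift_class (Posz n) D).
Proof.
move=> DE; elim: n => [|n IH].
  suff -> : shift_class 0 D = D by [].
  apply/seteqP; split=> [M [N DN MN]|]; last exact: shift_class0.
  exact: ext_smashing_iso DE (iso_sym MN) DN.
suff -> : shift_class (Posz n.+1) D = shift_class 1 (shift_class (Posz n) D).
  exact: ext_smashing_shift1.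
apply/seteqP; split=> [M [N DN MN]|M [N [N' DN' NN'] MN]].
  by exists (shiftz n N) => //; exact: shift_class_sub.
by exists N' => //; exact: iso_trans MN (fobj_iso sh NN').
Qed.

(** The bottom cell of an object of weights at least [n]; since [Q] is closed
    under small coproducts a single shifted object of [Q] suffices. *)
Lemma bottom_cell A Q (n : nat) : smashing C A -> ext_smashing A Q ->
  negative A Q -> gen_shifts A Q (from n) `<=`
    decomposable (shift_class n Q) (gen_shifts A Q (from n.+1)).
Proof.
move=> CA QE Qneg; apply: gen_min.
  apply: ext_smashing_decomposable => //; first exact: ext_smashing_shift.
    exact: gen_ext_smashing.
  move=> X Y QX gY f; apply: (negative_shifts (j := n.+1) Qneg _ QX); first by lia.
  by apply: gen_shifts_sh gY => i; rewrite /from /=; lia.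
move=> M [i ni QM]; have [in_|ni'] := eqVneq i n.
  by rewrite in_ in QM; apply: decomposable_left QM; exact: gen_extension.
apply: decomposable_right; first exact: (ext_smashing_shift n QE).1.
by apply: gen_shifts_sub QM; move: ni ni'; rewrite /from /=; lia.
Qed.

(** The maps from an object of the heart to objects of positive weights are
    zero, so its bottom cell retracts onto it. *)
Lemma generated_heartE A P w : infinite_regular A -> w_smashing_generated A P w ->
  forall M, heart w M <-> exists2 S, small_coproducts A P S & retract M S.
Proof.
move=> hA wP M.
have [wPle wPge] : P `<=` wle w /\ P `<=` wge w.
  by split=> X /(generated_heart wP)[].
split=> [[leM geM]|[S QS MS]]; last first.
  split.
    apply: wle_retract MS _; apply: small_coproducts_min QS => //.
    exact: (ext_smashing_wle A w).2.
  apply: wge_retract MS _; apply: small_coproducts_min QS => //.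
  exact: (generated_smashing wP).2.
have CA : smashing C A by case: wP.
have Qneg := negative_small_coproducts (generated_negative wP).
have QE := ext_smashing_negative hA.1 (small_coproducts_smashing hA) Qneg.
have {}geM : gen_shifts A (small_coproducts A P) (from 0) M.
  move: geM; rewrite (generated_wge wP); apply: gen_min.
    exact: gen_ext_smashing.
  move=> X [i i0 [N PN XN]]; apply: (gen_shifts_sub i0).
  by exists N => //; exact: small_coproducts_sub hA.1 _ PN.
have [X [Y [u [v [t [d [S QS XS] gY]]]]]] := bottom_cell CA QE Qneg geM.
exists X; first exact: ext_smashing_iso QE (iso_sym XS) QS.
apply: (dist_v0_retract d); apply: (w_orth leM).
rewrite (generated_wge wP); apply/gen_from_succP.
exact: small_coproducts_shifts gY.
Qed.

End Weights.

(** * Exact functors *)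

Section ExactFunctors.
Local Open Scope ring_scope.
Variables (C D : tricat) (F : exact_functor C D) (A : Type).
Implicit Types (X Y : C) (P : set C) (I : set int).

Lemma fobj_sh X : iso (F (sh X)) (sh (F X)).
Proof. by exists (esh F X); exact: esh_iso. Qed.

Lemma fobj_unsh X : iso (F (unsh X)) (unsh (F X)).
Proof.
apply: sh_iso; apply: iso_trans (iso_sym (fobj_sh _)) _.
apply: iso_trans (fobj_iso F (sh_unsh X)) _; exact/iso_sym/sh_unsh.
Qed.

Lemma fobj_shiftz i X : iso (F (shiftz i X)) (shiftz i (F X)).
Proof.
case: i => n; elim: n => [|n IH]; first exact: iso_refl.
- exact: iso_trans (fobj_sh _) (fobj_iso sh IH).
- exact: fobj_unsh.
- exact: iso_trans (fobj_unsh _) (unsh_iso IH).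
Qed.

Hypothesis FA : respects_coproducts A F.

Lemma ext_smashing_preimage E :
  ext_smashing A E -> ext_smashing A [set X | E (F X)].
Proof.
move=> [Ee Es]; split; first split=> [Z Z0|X Y Z u v w /(efun_dist F)].
- by apply: Ee.1; exact: (fobj_zero F).
- exact: Ee.2.
- by move=> I X S inj IA cop; exact: Es IA (FA IA cop).
Qed.

Lemma gen_shifts_image P I X :
  gen_shifts A P I X -> gen_shifts A (F @` P) I (F X).
Proof.
move: X; suff : gen_shifts A P I `<=` [set X | gen_shifts A (F @` P) I (F X)] by [].
apply: gen_min; first exact/ext_smashing_preimage/gen_ext_smashing.
move=> X [i Ii [Y PY XY]]; apply: (gen_shifts_sub Ii); exists (F Y) => //.
exact: iso_trans (fobj_iso F XY) (fobj_shiftz i Y).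
Qed.

Variables (P : set C) (w : weight_structure C) (v : weight_structure D).
Hypothesis wP : w_smashing_generated A P w.

Lemma left_weight_exactP : left_weight_exact w v F <-> F @` P `<=` wle v.
Proof.
split=> [Fw _ [X PX <-]|FP _ [X wX <-]].
  by apply: Fw; exists X => //; case: (generated_heart wP PX).
apply: (gen_upto_wle FP); apply: gen_shifts_image.
by rewrite -(generated_wle wP).
Qed.

Lemma right_weight_exactP : class_smashing A (wge v) ->
  right_weight_exact w v F <-> F @` P `<=` wge v.
Proof.
move=> vA; split=> [Fw _ [X PX <-]|FP _ [X wX <-]].
  by apply: Fw; exists X => //; case: (generated_heart wP PX).
apply: (gen_from_wge vA FP); apply: gen_shifts_image.
by rewrite -(generated_wge wP).
Qed.

Section Surjective.
Hypothesis natA : card_lt nat A.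
Hypothesis Fw : weight_exact w v F.
Hypothesis Fsurj : forall Y : D, exists X : C, F X = Y.

Let CA : smashing C A. Proof. by case: wP. Qed.
Let Fwle X : wle w X -> wle v (F X).
Proof. by move=> wX; apply: Fw.1; exists X. Qed.
Let Fwge X : wge w X -> wge v (F X).
Proof. by move=> wX; apply: Fw.2; exists X. Qed.

Lemma surjective_smashing : smashing D A.
Proof.
move=> I Y IA; have /dep_choice[X XY] : forall i, exists X, F X = Y i by [].
have [S [inj cop]] := CA X IA.
have -> : Y = fun i => F (X i) by apply: funext => i; rewrite XY.
by exists (F S), (fun i => fmap F (inj i)); exact: FA.
Qed.

(** The image of a weight decomposition of a preimage of [M] splits off [M],
    since one of its maps is zero for weight reasons. *)
Lemma surjective_wge_retract M :
  wge v M -> exists2 X, wge w X & retract M (F X).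
Proof.
have [N <-] := Fsurj M => vN.
have [L [R [a [b [t [d wL wR]]]]]] := w_decomp_sh w N; exists R => //.
apply: (dist_u0_retract (efun_dist F d)).
have LN : hom0 (F L) (F N); last exact: LN.
apply/hom0_sh; apply: hom0_iso (fobj_sh L) (iso_refl _) _ => f.
exact: w_orth (Fwle wL) (shift_class_sub 1 vN) f.
Qed.

Lemma surjective_wle_retract M :
  wle v M -> exists2 X, wle w X & retract M (F X).
Proof.
have [N <-] := Fsurj M => vN.
have [L [R [a [b [t [d wL [R' wR RR']]]]]]] := w_decomp w N; exists L => //.
apply: (dist_v0_retract (efun_dist F d)); apply: (w_orth vN).
exists (F R'); first exact: Fwge.
exact: iso_trans (fobj_iso F RR') (fobj_sh R').
Qed.

Lemma surjective_wge_smashing : class_smashing A (wge v).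
Proof.
move=> I M S inj IA cop vM.
have /dep_choice[X XP] : forall i, exists X, wge w X /\ retract (M i) (F X).
  by move=> i; have [X] := surjective_wge_retract (vM i); exists X.
have [T [k cT]] := CA X IA.
apply: wge_retract (coproduct_retract cop (FA IA cT) (fun i => (XP i).2)) _.
apply: Fwge; apply: (generated_smashing wP).2 IA cT _ => i.
by case: (XP i).
Qed.

(** By the two retraction lemmas and the swindle, both halves of [v] lie in
    the classes generated by the image of [P]. *)
Lemma surjective_generated : w_smashing_generated A (F @` P) v.
Proof.
have DA := surjective_smashing.
split=> //; apply/seteqP; split.
- move=> M /surjective_wge_retract[X wX MX].
  apply: (retract_closed_sh DA natA (gen_ext_smashing _ _)) MX _.
    by apply: gen_shifts_sh => i; rewrite /from /=; lia.
  by apply: gen_shifts_image; rewrite -(generated_wge wP).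
- apply: gen_from_wge; first exact: surjective_wge_smashing.
  by move=> _ [X PX <-]; apply: Fwge; case: (generated_heart wP PX).
- move=> M /surjective_wle_retract[X wX MX].
  apply: (retract_closed_unsh DA natA (gen_ext_smashing _ _)) MX _.
    by apply: gen_shifts_unsh => i; rewrite /upto /=; lia.
  by apply: gen_shifts_image; rewrite -(generated_wle wP).
- apply: gen_upto_wle.
  by move=> _ [X PX <-]; apply: Fwle; case: (generated_heart wP PX).
Qed.

End Surjective.

End ExactFunctors.

(** * Towers *)

Section Towers.
Local Open Scope ring_scope.
Variables (C : tricat) (A : Type).
Hypothesis CA : smashing C A.
Hypothesis natA : card_lt nat A.
Implicit Types (T : nat -> C) (P Q G : set C).

(** The homotopy colimit of the tower vanishes; phrased without the countable
    coproduct of its terms, so that it visibly passes to coproducts of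
    towers. *)
Definition null_tower T (t : forall n, hom (T n) (T n.+1)) : Prop :=
  forall (X : C) (x : forall n, hom (T n) X),
    exists! y : forall n, hom (T n) X, forall n, y n - y n.+1 \oc t n = x n.

Lemma null_tower_coproduct (J : Type) (T : J -> nat -> C)
    (t : forall j n, hom (T j n) (T j n.+1)) (S : nat -> C)
    (inj : forall n j, hom (T j n) (S n)) (s : forall n, hom (S n) (S n.+1)) :
  (forall n, is_coproduct (inj n)) ->
  (forall n j, s n \oc inj n j = inj n.+1 j \oc t j n) ->
  (forall j, null_tower (t j)) -> null_tower s.
Proof.
move=> cop sE null X x.
have /dep_choice[y yP] := fun j => null j X (fun n => x n \oc inj n j).
have /dep_choice[z zP] : forall n, exists z : hom (S n) X,
    forall j, z \oc inj n j = y j n.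
  by move=> n; have [z [zP _]] := cop n X (fun j => y j n); exists z.
exists z; split=> [n|z' z'P].
  apply: coproduct_eq (cop n) _ => j.
  by rewrite compDl compNm -compA sE compA !zP (yP j).1.
apply: functional_extensionality_dep => n; apply: coproduct_eq (cop n) _ => j.
have yE : y j = fun n => z' n \oc inj n j.
  by apply: (yP j).2 => m; rewrite -compA -sE compA -compNm -compDl z'P.
by rewrite zP yE.
Qed.

Section NullTower.
Variables (T : nat -> C) (t : forall n, hom (T n) (T n.+1)).

Fixpoint tower_map n : hom (T 0%N) (T n) :=
  if n is m.+1 then t m \oc tower_map m else idm (T 0%N).

Lemma tower_map_fiber G : extension_closed G ->
  (forall n, exists S (u : hom S (T n)) w, dist u (t n) w /\ G S) ->
  forall n, exists S (u : hom S (T 0%N)) w, dist u (tower_map n) w /\ G S.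
Proof.
move=> Ge cell; elim=> [|n [B [b [b' [dB GB]]]]].
  have [O O0] := has_zero C; exists O, 0, 0; split; last exact: Ge.1.
  by apply/dist_rot; rewrite fmap0 oppr0; exact: dist_id (fobj_zero sh O0).
have [S [u [w [dS GS]]]] := cell n.
have [K [k [k' dK]]] := dist_fiber (tower_map n.+1).
have [f [g [h d]]] := octahedron_fiber dB dS dK.
by exists K, k, k'; split=> //; exact: Ge.2 d GB GS.
Qed.

(** A null tower writes its first term as the homotopy colimit of the fibers
    [F n] of [T 0 -> T n]. Let [W], [K] and [F] be the countable coproducts of
    the copies of [T 0], of the [T n] and of the [F n]; the map identity minus
    shift is invertible on [K] and has [T 0] as a retract of its cone [Z] on
    [W]. It commutes with [W -> K], whose cone is [F[1]], so that the
    octahedron makes [Z] an extension of [F[1]] by [F]. *)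
Lemma null_tower_bottom G : ext_smashing A G ->
  (forall M, G M -> G (sh M)) -> null_tower t ->
  (forall n, exists S (u : hom S (T n)) w, dist u (t n) w /\ G S) -> G (T 0%N).
Proof.
move=> GE Gsh null /(tower_map_fiber GE.1).
move=> /dep_choice[Fn] /dep_choice[u] /dep_choice[w] fib.
have d n : dist (u n) (tower_map n) (w n) by case: (fib n).
have [F [jF cF]] := CA Fn natA.
have [W [jW cW]] := CA (fun=> T 0%N) natA.
have [U [UP _]] := cF W (fun n => jW n \oc u n).
have [K [V [V' D]]] := dist_cone U.
have [k [kV cK]] := coproduct_cone d cF cW UP D.
have GF : G F by apply: (GE.2 _ _ _ _ natA cF) => n; case: (fib n).
have [sK [sKP _]] := cK K (fun n => k n - k n.+1 \oc t n).
have [sW [sWP _]] := cW W (fun n => jW n - jW n.+1).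
(* The inverse is the solution of the null tower equation for [k]. *)
have sK_iso : is_iso sK.
  have [y [yP _]] := null K k; have [r [rP _]] := cK K y; exists r; split.
    apply: coproduct_eq cK _ => n.
    by rewrite -compA sKP compDr compmN compA !rP yP comp1m.
  have [z [_ zU]] := null K (fun n => sK \oc k n).
  have zk : z = k by apply: zU => n; rewrite sKP.
  have zy : z = fun n => sK \oc y n.
    by apply: zU => n; rewrite -compA -compmN -compDr yP.
  by apply: coproduct_eq cK _ => n; rewrite -compA rP comp1m -zk zy.
have VsW : V \oc sW = sK \oc V.
  apply: coproduct_eq cW _ => n; rewrite -!compA -kV sWP (compA sK) sKP.
  by rewrite compDr compmN -!kV compDl compNm -compA.
have [sK' [sK'K sKK']] := sK_iso.
have D' : dist (V \oc sW) (V' \oc sK') (- fmap sh U).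
  apply: (dist_iso (a := idm W) (b := sK) (c := idm _))
    ((dist_rot _ _ _).1 D) => //; try exact: is_iso_idm.
  - by rewrite compm1 VsW.
  - by rewrite comp1m -compA sK'K compm1.
  - by rewrite fmap1 comp1m compm1.
have [Z [i [i' DZ]]] := dist_cone sW.
have [f [g [h DF]]] := octahedron DZ ((dist_rot _ _ _).1 D) D'.
have [e dZ] := dist_unrot DF.
have GZ : G Z by exact: GE.1.2 dZ GF (Gsh _ GF).
apply: (retract_closed_sh CA natA GE Gsh) GZ.
(* The codiagonal kills identity minus shift, so it factors through [Z]; this
   splits the map from the first copy of [T 0] to [Z]. *)
have [nabla [nablaP _]] := cW (T 0%N) (fun=> idm _).
have [|p pE] := dist_factor (f := nabla) DZ.
  apply: coproduct_eq cW _ => n; rewrite -compA sWP compDr compmN !nablaP.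
  by rewrite comp0m subrr.
by exists (i \oc jW 0%N), p; rewrite compA -pE nablaP.
Qed.

(** A tower of ever higher weights is null. Maps into the coproduct [K] of its
    terms from an object of [Q[m]] are killed by the [m]-th power of the
    shift, which factors through the terms from [T m] on; hence identity minus
    shift is bijective on these maps, its cone receives no map from the
    generators of the subcategory containing it, and so vanishes. *)
Lemma null_tower_weights Q : negative A Q ->
  (forall n, gen_shifts A Q (from n.+1) (T n)) -> null_tower t.
Proof.
move=> Qneg gT.
have [K [k cK]] := CA T natA.
have [s [sP _]] := cK K (fun n => k n.+1 \oc t n).
have factor m X (f : hom X K) : exists (Km : C)
    (j : forall n, hom (T (m + n)%N) Km) (i : hom Km K) (g : hom X Km),
    [/\ is_coproduct j, forall n, i \oc j n = k (m + n)%N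
      & iter m (comp s) f = i \oc g].
  elim: m => [|m [Km [j [i [g [cj ij fE]]]]]].
    by exists K, k, (idm K), f; split=> // [n|]; rewrite comp1m.
  have [Km' [j' cj']] := CA (fun n => T (m.+1 + n)%N) natA.
  have [i' [i'P _]] := cj' K (fun n => k (m.+1 + n)%N).
  have [r [rP _]] := cj Km' (fun n => j' n \oc t (m + n)%N).
  exists Km', j', i', (r \oc g); split=> //.
  rewrite iterS fE !compA; congr (_ \oc g); apply: coproduct_eq cj _ => n.
  by rewrite -!compA ij rP sP compA i'P.
have nil (m : nat) X (f : hom X K) : shift_class m Q X -> iter m (comp s) f = 0.
  move=> QX; have [Km [j [i [g [cj _ ->]]]]] := factor m X f.
  have gKm : gen_shifts A Q (from m.+1) Km.
    apply: (gen_smashing natA cj) => n; apply: gen_shifts_le (gT _) => l.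
    by rewrite /from /=; lia.
  by rewrite (negative_shifts Qneg _ QX gKm g) ?compm0//; lia.
have shift_inj (m : nat) X (f : hom X K) :
    shift_class m Q X -> f - s \oc f = 0 -> f = 0.
  move=> QX /eqP; rewrite subr_eq0 => /eqP fE; rewrite -(nil m X f QX).
  by elim: m {QX} => [//|m IH]; rewrite iterS -IH.
have shift_surj (m : nat) X (f : hom X K) :
    shift_class m Q X -> exists g, f = g - s \oc g.
  move=> /(nil _ _ f); elim: m f => [f /= ->|m IH f].
    by exists 0; rewrite compm0 subrr.
  rewrite iterSr => /IH[g gE]; exists (f + g).
  by rewrite compDr opprD addrACA -gE subrK.
have [R [v [w d]]] := dist_cone (idm K - s).
have sE X (f : hom X K) : (idm K - s) \oc f = f - s \oc f.
  by rewrite compDl compNm comp1m.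
have gK : gen_shifts A Q (from 1) K.
  apply: (gen_smashing natA cK) => n; apply: gen_shifts_le (gT n) => l.
  by rewrite /from /=; lia.
have gR : gen_shifts A Q (from 1) R.
  have gshK : gen_shifts A Q (from 1) (sh K).
    by apply: gen_shifts_sh gK => l; rewrite /from /=; lia.
  exact: (gen_extension A _).2 ((dist_rot _ _ _).1 d) gK gshK.
have R0 : is_zero R.
  suff : [set X | forall Y, [set R] Y -> hom0 X Y] R.
    by move=> /(_ R erefl (idm R)).
  apply: gen_min gR; first exact: ext_smashing_left_orth.
  (* [R] is generated by the [Q[m + 1]] for natural [m], so unshifting a
     generator, as the connecting map [w] requires, stays within the [Q[m]]. *)
  move=> X [[[//|m]|//] _ QX] _ -> f.
  have wf0 : w \oc f = 0.
    have X'X := sh_unsh X; have [a [a' [_ aa']]] := X'X.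
    have [h hE] := sh_surj (w \oc f \oc a).
    have h0 : h = 0.
      apply: (shift_inj m); first have := shift_classD (Negz 0) QX.
        by rewrite (_ : Negz 0 + Posz m.+1 = m); last by lia.
      rewrite -sE; apply: sh_inj; rewrite fmapM hE !compA fmap0.
      have /eqP := dist_comp0 ((dist_rot _ _ _).1 ((dist_rot _ _ _).1 d)).
      by rewrite compNm oppr_eq0 => /eqP ->; rewrite !comp0m.
    by rewrite -[w \oc f]compm1 -aa' compA -hE h0 fmap0 comp0m.
  have [g ->] := dist_lift ((dist_rot _ _ _).1 d) wf0.
  have [h ->] := shift_surj _ _ g QX.
  by rewrite -sE compA (dist_comp0 d) comp0m.
have [r [rs sr]] := dist_iso_of_zero d R0.
have sigmaE X (f : hom K X) n :
    f \oc (idm K - s) \oc k n = f \oc k n - f \oc k n.+1 \oc t n.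
  by rewrite -compA sE compDr compmN sP compA.
move=> X x; have [x' [x'P _]] := cK X x.
exists (fun n => x' \oc r \oc k n); split=> [n|y yP].
  by rewrite -sigmaE -(compA x') rs compm1 x'P.
have [y' [y'P _]] := cK X y.
have y'E : y' \oc (idm K - s) = x'.
  by apply: coproduct_eq cK _ => n; rewrite sigmaE !y'P yP x'P.
apply: functional_extensionality_dep => n.
by rewrite -y'E -(compA y') sr compm1 y'P.
Qed.

End NullTower.

(** The tower is obtained by splitting off bottom cells one after another. *)
Lemma weight_tower Q N : ext_smashing A Q -> negative A Q ->
  gen_shifts A Q (from 1) N ->
  exists T (t : forall n, hom (T n) (T n.+1)),
    [/\ T 0%N = N, forall n, gen_shifts A Q (from n.+1) (T n)
      & forall n, exists S (u : hom S (T n)) w,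
          dist u (t n) w /\ shift_class n.+1 Q S].
Proof.
move=> QE Qneg gN.
pose st n := {M : C | gen_shifts A Q (from (Posz n.+1)) M}.
have /dep_choice[f] : forall p : {n & st n}, exists M' : st (projT1 p).+1,
    exists t : hom (sval (projT2 p)) (sval M'),
    exists S (u : hom S (sval (projT2 p))) w,
      dist u t w /\ shift_class (projT1 p).+1 Q S.
  move=> [n [M gM]] /=.
  have [S [M' [u [t [w [d QS gM']]]]]] := bottom_cell CA QE Qneg gM.
  by exists (exist _ M' gM'), t, S, u, w.
move=> /dep_choice[t tP].
pose T := nat_rect st (exist _ N gN) (fun n M => f (existT _ n M)).
exists (fun n => sval (T n)), (fun n => t (existT _ n (T n))); split=> // n.
- exact: svalP (T n).
- exact: tP (existT _ n (T n)).
Qed.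

End Towers.

(** * Large coproducts in classes generated by small ones *)

Section LargeCoproducts.
Local Open Scope ring_scope.
Variables (C : tricat) (A B : Type).
Implicit Types P Q D : set C.
Hypothesis CA : smashing C A.
Hypothesis BA : [set: B] #<= [set: A].

Lemma class_smashing_le D : class_smashing A D -> class_smashing B D.
Proof. by move=> DA I X S inj IB; apply: DA; exact: card_lt_le IB BA. Qed.

Lemma smashing_le : smashing C B.
Proof. by move=> I X IB; apply: CA; exact: card_lt_le IB BA. Qed.

Lemma gen_card_le P : gen B P `<=` gen A P.
Proof.
apply: gen_min (@gen_sub _ A P); split; first exact: gen_extension.
by apply: class_smashing_le; exact: gen_smashing.
Qed.

(** The class generated by [Q] under countable coproducts is automatically
    closed under those coproducts under which [Q] is: the coproduct of the
    towers of the summands is null, and its cells are coproducts of cells. *)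
Lemma gen_positive_smashing Q : card_lt nat B -> class_smashing A Q ->
  negative B Q -> class_smashing A (gen_shifts B Q (from 1)).
Proof.
move=> natB QA Qneg.
have CB := smashing_le.
have QB := ext_smashing_negative natB.1 (class_smashing_le QA) Qneg.
have GE : ext_smashing B (gen_shifts B Q (from 1)) by exact: gen_ext_smashing.
have Gsh M : gen_shifts B Q (from 1) M -> gen_shifts B Q (from 1) (sh M).
  by apply: gen_shifts_sh => i; rewrite /from /=; lia.
move=> J N S inj JA cop gN.
have /dep_choice[T] := fun j => weight_tower CB QB Qneg (gN j).
move=> /dep_choice[t] tow.
have /dep_choice[S'] := fun n => CA (fun j => T j n) JA.
move=> /dep_choice[inj'] cop'.
have /dep_choice[s sP] : forall n, exists s : hom (S' n) (S' n.+1),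
    forall j, s \oc inj' n j = inj' n.+1 j \oc t j n.
  move=> n; have [s [sP _]] := cop' n _ (fun j => inj' n.+1 j \oc t j n).
  by exists s.
have null : null_tower s.
  apply: (null_tower_coproduct cop' sP) => j; have [_ gT _] := tow j.
  exact: null_tower_weights CB natB _ _ Q Qneg gT.
have GR := retract_closed_sh CB natB GE Gsh; apply: (GR S (S' 0%N)).
  apply: (coproduct_retract cop (cop' 0%N)) => j.
  by have [-> _ _] := tow j; exact/retract_iso/iso_refl.
apply: (null_tower_bottom CB natB GE Gsh null) => n.
have [F [u [w d]]] := dist_fiber (s n); exists F, u, w; split=> //.
have /dep_choice[E] : forall j, exists E (u : hom E (T j n)) w,
    dist u (t j n) w /\ shift_class n.+1 Q E by move=> j; case: (tow j).
move=> /dep_choice[a] /dep_choice[b] cell.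
have [k ck] := coproduct_fiber (fun j => (cell j).1) (cop' n) (cop' n.+1) (sP n) d.
apply: (@gen_shifts_sub _ _ _ (from 1) n.+1); first by rewrite /from /=; lia.
have [_ QnA] := ext_smashing_shift n.+1 (conj QB.1 QA : ext_smashing A Q).
by apply: QnA JA ck _ => j; case: (cell j).
Qed.

(** Closure of the class generated by [Q] under all small coproducts makes it
    contain the class generated by [P] under them. *)
Lemma negative_countably P : card_lt nat B -> infinite_regular A ->
  negative A P <-> negative B (small_coproducts A P).
Proof.
move=> natB hA; split=> [Pneg M N QM gN f|Qneg M N PM gN f].
  exact: negative_small_coproducts Pneg M N QM (gen_card_le gN) f.
have PQ : P `<=` small_coproducts A P by exact: small_coproducts_sub hA.1.
apply: (Qneg M N (PQ _ PM) _ f); apply: gen_min gN.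
  split; first exact: gen_extension.
  exact: gen_positive_smashing natB (small_coproducts_smashing hA) Qneg.
move=> X [i i0 [Y PY XY]]; apply: gen_sub; exists i => //.
by exists Y => //; exact: PQ.
Qed.

End LargeCoproducts.

(** * Localizing subcategories *)

Section LocalizingSubcategory.
Local Open Scope ring_scope.
Variables (C : tricat) (A : Type) (P : set C).
Hypothesis CA : smashing C A.
Let L : tricat := loc_subcat A P.

(** The coproduct taken in [C] lies in the subcategory, where it is isomorphic
    to the given one. *)
Lemma loc_coproduct (I : Type) (X : I -> L) (S : L)
    (inj : forall i, hom (X i) S) : card_lt I A -> is_coproduct inj ->
  @is_coproduct C I (fun i => sval (X i)) (sval S) inj.
Proof.
move=> IA cop; have [T [k cT]] := CA (fun i => sval (X i)) IA.
have LT : loc A P T by apply: (gen_smashing IA cT) => i; exact: svalP (X i).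
pose T' : L := exist _ T LT.
have cT' : @is_coproduct L I X T' k by move=> U f; exact: cT (sval U) f.
have [a [aP _]] := cop T' k; have [b [bP _]] := cT' S inj.
apply: (coproduct_iso (a := fun i => idm (sval (X i))) (s := b)) cT.
- by move=> i; exact: is_iso_idm.
- exists a; split.
    by apply: (coproduct_eq cT') => i; rewrite -compA bP aP comp1m.
  by apply: (coproduct_eq cop) => i; rewrite -compA aP bP comp1m.
- by move=> i; rewrite compm1; exact: bP.
Qed.

Lemma loc_smashing : smashing L A.
Proof.
move=> I X IA; have [T [k cT]] := CA (fun i => sval (X i)) IA.
have LT : loc A P T by apply: (gen_smashing IA cT) => i; exact: svalP (X i).
by exists (exist _ T LT), k => U f; exact: cT (sval U) f.
Qed.

Lemma sval_shiftz i (M : L) : sval (shiftz i M) = shiftz i (sval M).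
Proof.
case: i => n; elim: n => [|n IH] //.
  by transitivity (sh (sval (shiftz n M))); last rewrite IH.
by transitivity (unsh (sval (shiftz (Negz n) M))); last rewrite IH.
Qed.

Lemma loc_negative : negative A P -> negative A (loc_class A P).
Proof.
move=> Pneg M N PM gN f; apply: (Pneg (sval M) (sval N) PM) => {M PM f}.
suff : gen A (\bigcup_(i in from 1) shift_class i (loc_class A P)) `<=`
    [set X : L | gen_shifts A P (from 1) (sval X)] by exact.
have [ge gs] := gen_ext_smashing A (\bigcup_(i in from 1) shift_class i P).
apply: gen_min; first split; first split.
- by move=> Z Z0; exact: ge.1.
- by move=> X Y Z u v w d; exact: ge.2 d.
- by move=> I X S inj IA cop; exact: gs IA (loc_coproduct IA cop).
- move=> X [i i0 [Y PY XY]]; apply: gen_sub; exists i => //.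
  by exists (sval Y) => //; rewrite -sval_shiftz.
Qed.

Lemma loc_generated (M : L) : loc A (loc_class A P) M.
Proof.
suff : [set X | exists LX : loc A P X, loc A (loc_class A P) (exist _ X LX : L)]
    (sval M).
  by case: M => X LX [LX' /=]; rewrite (Prop_irrelevance LX LX').
apply: gen_min (svalP M); first split; first split.
- move=> Z Z0; exists ((gen_extension A _).1 Z Z0).
  exact: (gen_extension A _).1.
- move=> X Y Z u v w d [LX gX] [LZ gZ].
  have LY : loc A P Y by exact: (gen_extension A _).2 d LX LZ.
  have dL : @dist L (exist _ X LX) (exist _ Y LY) (exist _ Z LZ) u v w by [].
  by exists LY; exact: (gen_extension A _).2 dL gX gZ.
- move=> I X S inj IA cop /dep_choice[LX gX].
  have LS : loc A P S by exact: gen_smashing IA cop LX.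
  have copL : @is_coproduct L I (fun i => exist _ (X i) (LX i)) (exist _ S LS) inj.
    by move=> U f; exact: cop (sval U) f.
  by exists LS; exact: gen_smashing IA copL gX.
- move=> X [i _ [Y PY XY]].
  have LY : loc A P Y by apply: gen_sub; exists 0 => //; exact: shift_class0.
  have LX : loc A P X by apply: gen_sub; exists i => //; exists Y.
  exists LX; apply: gen_sub; exists i => //; exists (exist _ Y LY : L) => //.
  change (@iso C X (sval (shiftz i (exist _ Y LY : L)))).
  by rewrite sval_shiftz.
Qed.

End LocalizingSubcategory.

Theorem theorem2p2p1 (A : Type) (hA : infinite_regular A) :
  (* (1) *)
  (card_lt nat A ->
   forall (C' : tricat) (P : set C'),
     smashing C' A -> negative A P ->
     exists w : weight_structure (loc_subcat A P),
       w_smashing A w /\ w_smashing_generated A (loc_class A P) w) /\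
  (* (2) *)
  (forall (C : tricat) (w : weight_structure C) (P : set C),
     smashing C A -> w_smashing_generated A P w ->
     [/\ negative A P, left_nondegenerate w & w_generated P w]) /\
  (* (3) *)
  (forall (C : tricat) (w : weight_structure C) (P : set C),
     smashing C A -> w_smashing_generated A P w ->
     forall M : C, heart w M <->
       exists2 S : C, small_coproducts A P S & retract M S) /\
  (* (4) *)
  (forall (C : tricat) (w : weight_structure C) (P : set C)
          (D : tricat) (v : weight_structure D) (F : exact_functor C D),
     smashing C A -> w_smashing_generated A P w ->
     respects_coproducts A F ->
     (left_weight_exact w v F <-> F @` P `<=` wle v) /\
     (w_smashing A v ->
      (right_weight_exact w v F <-> F @` P `<=` wge v))) /\
  (* (5) *)
  (card_lt nat A ->
   (forall (C : tricat) (w : weight_structure C) (P : set C)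
           (D : tricat) (v : weight_structure D) (F : exact_functor C D),
      smashing C A -> w_smashing_generated A P w ->
      respects_coproducts A F ->
      weight_exact w v F -> (forall Y : D, exists X : C, F X = Y) ->
      w_smashing_generated A (F @` P) v) /\
   (forall (C : tricat) (w : weight_structure C) (P : set C),
      smashing C A -> w_smashing_generated A P w ->
      w_smashing A w /\ P `<=` heart w /\
      forall w' : weight_structure C,
        w_smashing A w' -> P `<=` heart w' ->
        wle w' = wle w /\ wge w' = wge w)) /\
  (* (6) *)
  (forall Aleph1 : Type, is_aleph1 Aleph1 ->
   [set: Aleph1] #<= [set: A] ->
   forall (C : tricat) (P : set C), smashing C A ->
     (negative A P <-> negative Aleph1 (small_coproducts A P))).
Proof.
split; [|split; [|split; [|split; [|split]]]].
- move=> natA C P CA Pneg; have LA := loc_smashing CA (P := P).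
  have [w [wge_w wle_w]] := weight_structure_of_negative LA natA
    (loc_negative CA Pneg) (@loc_generated C A P).
  exists w; split; split=> //; rewrite wge_w; exact: gen_smashing.
- move=> C w P CA wP; split; first exact: generated_negative wP.
    exact: generated_left_nondegenerate wP.
  exact: generated_w_generated wP.
- by move=> C w P CA wP M; exact: generated_heartE hA wP M.
- move=> C w P D v F CA wP FA; split; first exact (left_weight_exactP FA v wP).
  by move=> [_ vA]; exact (right_weight_exactP FA wP vA).
- move=> natA; split=> [C w P D v F CA wP FA Fw Fsurj|C w P CA wP].
    exact (surjective_generated FA wP natA Fw Fsurj).
  split; first exact: generated_smashing wP.
  split; first exact: generated_heart wP.
  move=> w' [_ wA'] Pw'; apply: weight_structure_incl.
    rewrite (generated_wle wP); apply: gen_upto_wle => M PM.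
    by case: (Pw' M PM).
  rewrite (generated_wge wP); apply: gen_from_wge => // M PM.
  by case: (Pw' M PM).
- move=> B [natB _] BA C P CA; exact (negative_countably CA BA P natB hA).
Qed.
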